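(* Let $\mathcal{H}=\mathcal{H}(\Omega)$ be a functional (reproducing kernel) Hilbert space on a nonempty set $\Omega$ and let $A\in\mathcal{B}(\mathcal{H})$. Let $g,h$ be two nonnegative continuous functions on $[0,\infty)$ satisfying $g(s)h(s)=s$ for all $s\ge0$. Then for any function $f:(0,1)\to[0,\infty)$, any $t\in(0,1)$ and any sub-multiplicative Orlicz function $\phi$, $$\begin{aligned}\phi\left(\mathbf{ber}^2(A)\right)\le{}&\frac{f(t)}{2(1+f(t))}\left(\frac12\,\mathbf{ber}\left(\phi\left(g^4(|A|)\right)+\phi\left(h^4(|A^*|)\right)\right)+\phi\left(\mathbf{ber}\left(h^2(|A^*|)\,g^2(|A|)\right)\right)\right)\\&+\frac{1}{2(1+f(t))}\,\phi\left(\mathbf{ber}(A)\right)\,\mathbf{ber}\left(\phi\left(g^2(|A|)\right)+\phi\left(h^2(|A^*|)\right)\right).\end{aligned}$$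
   Context: A functional (reproducing kernel) Hilbert space $\mathcal{H}=\mathcal{H}(\Omega)$ is a Hilbert space of complex-valued functions on a nonempty set $\Omega$ such that for every $\lambda\in\Omega$ the evaluation $f\mapsto f(\lambda)$ is a continuous linear functional; $k_\lambda\in\mathcal{H}$ is the unique element with $f(\lambda)=\langle f,k_\lambda\rangle$ for all $f\in\mathcal{H}$. It is assumed that $k_\lambda\neq0$ for all $\lambda\in\Omega$, and $\hat{k}_\lambda=k_\lambda/\|k_\lambda\|$ is the normalized reproducing kernel. $\mathcal{B}(\mathcal{H})$ is the algebra of bounded linear operators on $\mathcal{H}$; $|A|=(A^*A)^{1/2}$. The Berezin number of $A\in\mathcal{B}(\mathcal{H})$ is $\mathbf{ber}(A)=\sup_{\lambda\in\Omega}|\langle A\hat{k}_\lambda,\hat{k}_\lambda\rangle|$, and $\mathbf{ber}^p(A)=(\mathbf{ber}(A))^p$. Functions of positive operators are taken in the continuous functional calculus; $g^p(|A|)=(g(|A|))^p$, and similarly for $h$. An Orlicz function is a function $\phi:[0,\infty)\to[0,\infty)$ that is continuous, convex and increasing, with $\phi(0)=0$ and $\phi(t)\to+\infty$ as $t\to+\infty$; it is sub-multiplicative if $\phi(xy)\le\phi(x)\phi(y)$ for all $x,y\ge0$. *)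

(* Defs.v *)
From HB Require Import structures.
From mathcomp Require Import all_boot all_order all_algebra complex.
From mathcomp Require Import all_classical all_reals all_analysis.

Set Implicit Arguments.
Unset Strict Implicit.
Unset Printing Implicit Defensive.

Import Order.TTheory GRing.Theory Num.Theory numFieldNormedType.Exports.
Local Open Scope classical_set_scope.
Local Open Scope ring_scope.
Local Open Scope complex_scope.

(* The norm is part of the Banach-space structure; [rkhs_normE] says that it is
   the norm of the inner product, so that completeness and continuity refer to
   the Hilbert norm. [rkhs_inner] is linear in its first argument. Elements of
   the space are identified with functions on Omega via the injective linear
   map [rkhs_eval]. *)
Record rkhs (R : realType) (Omega : Type) := Rkhs {
  rkhs_space :> completeNormedModType R[i] ;
  rkhs_inner : {dot rkhs_space for (@Num.conj R[i])} ;
  rkhs_normE : forall u : rkhs_space, `|u| ^+ 2 = rkhs_inner u u ;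
  rkhs_eval : rkhs_space -> Omega -> R[i] ;
  rkhs_eval_linear : forall l, linear (rkhs_eval^~ l : rkhs_space -> R[i]^o) ;
  rkhs_eval_inj : injective rkhs_eval ;
  rkhs_eval_continuous :
    forall l, continuous (rkhs_eval^~ l : rkhs_space -> R[i]^o) }.

Section operators.
Context {R : realType} {Omega : Type} {H : rkhs R Omega}.
Implicit Types (T S P : H -> H) (u v : H) (g : R -> R).

Local Notation "<< u , v >>" := (rkhs_inner H u v).

Definition bounded_operator T := linear T /\ continuous T.

(* Meaningful for a bounded operator T; norms take values in R[i], hence Re. *)
Definition opnorm T : R :=
  sup [set complex.Re `|T u| | u in [set u : H | `|u| <= 1]].

Definition adjoint T : H -> H :=
  fun v => xget 0 [set w | forall u, <<T u, v>> = <<u, w>>].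

Definition spectrum T : set R[i] :=
  [set z | ~ exists S, [/\ bounded_operator S,
     forall u, S (T u - z *: u) = u & forall u, T (S u) - z *: S u = u]].

Definition poly_op (p : {poly R}) T : H -> H :=
  fun u => \sum_(i < size p) (p`_i)%:C *: iter i T u.

(* Continuous functional calculus of a self-adjoint operator P: g(P) is the
   limit, in operator norm, of p_n(P), where the polynomials p_n converge to g
   uniformly on the spectrum of P. The latter is real, so that real points and
   real coefficients suffice. *)
Definition is_cfc g P T := bounded_operator T /\
  exists p : nat -> {poly R},
    {uniform [set r : R | spectrum P r%:C],
       (fun n r => (p n).[r]) @ \oo --> g} /\
    opnorm (poly_op (p n) P \- T) @[n --> \oo] --> (0 : R).

Definition cfc g P : H -> H := xget (fun=> 0) [set T | is_cfc g P T].

Definition abs_op T : H -> H := cfc Num.sqrt (adjoint T \o T).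

Definition rkernel (l : Omega) : H :=
  xget 0 [set k | forall u, rkhs_eval u l = <<u, k>>].

Definition nrkernel (l : Omega) : H := `|rkernel l|^-1 *: rkernel l.

Definition ber T : R :=
  sup [set complex.Re `| <<T (nrkernel l), nrkernel l>> | | l in [set: Omega]].

End operators.

(* "Increasing" is taken in the weak sense; for a nonzero submultiplicative
   convex function vanishing at 0 this amounts to strict monotonicity. *)
Record orlicz (R : realType) (phi : R -> R) : Prop := Orlicz {
  orlicz_ge0 : forall x : R, 0 <= x -> 0 <= phi x ;
  orlicz_continuous : {within `[0, +oo[, continuous phi} ;
  orlicz_convex : convex_function (`[0, +oo[ : set R) phi ;
  orlicz_increasing : {in `[0, +oo[ &, {homo phi : x y / x <= y}} ;
  orlicz0 : phi 0 = 0 ;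
  orlicz_cvg : phi x @[x --> +oo] --> +oo }.

Definition submultiplicative (R : realType) (phi : R -> R) :=
  forall x y : R, 0 <= x -> 0 <= y -> phi (x * y) <= phi x * phi y.

(* Main.v *)
Require Import Defs.
From HB Require Import structures.
From mathcomp Require Import all_boot all_order all_algebra complex.
From mathcomp Require Import all_classical all_reals all_analysis.
From mathcomp Require Import ring lra.
Set Implicit Arguments.
Unset Strict Implicit.
Unset Printing Implicit Defensive.
Import Order.TTheory GRing.Theory Num.Theory numFieldNormedType.Exports.
Local Open Scope classical_set_scope.
Local Open Scope ring_scope.
Local Open Scope complex_scope.

(** Let k be a normalized kernel, a = |<A k, k>|, G = g(|A|) and K = h(|A^*|).
    The mixed Schwarz inequality [mixed_schwarz] gives
    a^2 <= <G^2 k, k> <K^2 k, k>, and phi(a^2) is bounded in two ways. By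
    [buzano], a^2 is at most half of |G^2 k| |K^2 k| + |<K^2 G^2 k, k>|, and
    |G^2 k| |K^2 k| <= (<G^4 k, k> + <K^4 k, k>) / 2. On the other hand
    a <= (<G^2 k, k> + <K^2 k, k>) / 2 and phi(a^2) <= phi(a) phi(a). Convexity
    of phi and Jensen's inequality phi(<Q k, k>) <= <phi(Q) k, k> for Q >= 0
    ([operator_jensen]) turn these into bounds by Berezin numbers, which are
    averaged with the weights f(t) / (1 + f(t)) and 1 / (1 + f(t)); continuity of
    phi then allows taking the supremum over k ([orlicz_ber_le]).

    All this rests on the continuous functional calculus of a positive operator
    P. Its core is [psd_poly_op]: a real polynomial p that is nonnegative on the
    spectrum of P satisfies p(P) >= 0. This comes from the facts that the infimum
    of the quadratic form of a symmetric operator is in its spectrum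
    ([spectrum_inf]), that the spectrum is real ([spectrum_real]), and that p
    splits over the complex numbers ([cpoly_op_invertible]). It bounds the norm
    of p(P) by the supremum of |p| on the spectrum; with the Weierstrass theorem
    and completeness, g(P) then exists for every g continuous on [0, +oo[
    ([is_cfc_exists]), and is multiplicative, monotone, and compatible with
    operators intertwining P and Q ([cfc_mul], [cfc_le], [cfc_intertwine]). Adjoints
    and inverses come from a Lax-Milgram lemma, proved by minimising a quadratic
    functional.

    The mixed Schwarz inequality needs no polar decomposition: it follows from
    the Cauchy-Schwarz inequality for the operator g(|A|)^2 + e, whose inverse is
    carried by A to a function of |A^*|. *)

(** * Inner product and norm *)

Section ComplexModulus.
Context {R : realType}.
Implicit Types z w : R[i].

(** The modulus of a complex number, as a real number. *)
Definition cabs z : R := complex.Re `|z|.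

Lemma cabsE z : `|z| = (cabs z)%:C.
Proof. by rewrite /cabs normc_def. Qed.

Lemma cabs_ge0 z : 0 <= cabs z.
Proof. by rewrite -ler0c -cabsE. Qed.

Lemma cabsM z w : cabs (z * w) = cabs z * cabs w.
Proof. by apply: (@complexI R); rewrite -cabsE normrM !cabsE rmorphM. Qed.

Lemma cabsR (x : R) : cabs x%:C = `|x|.
Proof. by rewrite /cabs normc_def /= expr0n addr0 sqrtr_sqr. Qed.

Lemma cabs_sqr z : cabs z ^+ 2 = complex.Re z ^+ 2 + complex.Im z ^+ 2.
Proof. by rewrite /cabs normc_def /= sqr_sqrtr // addr_ge0 ?sqr_ge0. Qed.

Lemma ler_cabsD z w : cabs (z + w) <= cabs z + cabs w.
Proof. by rewrite -lecR rmorphD /= -!cabsE ler_normD. Qed.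

Lemma cabs_eq0 z : (cabs z == 0) = (z == 0).
Proof. by rewrite -(inj_eq (@complexI R)) -cabsE normr_eq0. Qed.

Lemma ler_Re_cabs z : complex.Re z <= cabs z.
Proof.
have [h|/ltW h] := leP 0 (complex.Re z); last exact: le_trans h (cabs_ge0 _).
by rewrite -(ler_pXn2r (n := 2)) ?nnegrE ?cabs_ge0// cabs_sqr lerDl sqr_ge0.
Qed.

Lemma cabs_conj z : cabs z^* = cabs z.
Proof. by rewrite /cabs normcJ. Qed.

End ComplexModulus.

(** Cauchy-Schwarz in scalar form: a and d are the values of a semidefinite form
    at two vectors, and x is the squared modulus of its off-diagonal value. *)
Lemma discriminant_le (R : realFieldType) (a d x : R) :
  0 <= a -> 0 <= d -> 0 <= x ->
  (forall s, 0 <= a - 2 * s * x + s ^+ 2 * x * d) -> x <= a * d.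
Proof.
move=> a0 d0 x0 h; have [dp|] := ltP 0 d.
  have := h d^-1.
  have -> : a - 2 * d^-1 * x + d^-1 ^+ 2 * x * d = (a * d - x) / d.
    by field; lra.
  by rewrite pmulr_lge0 ?invr_gt0// subr_ge0.
move=> dn; have -> : d = 0 by apply/eqP; rewrite eq_le dn d0.
rewrite mulr0 leNgt; apply/negP => xp.
have := h ((a + 1) / x).
have -> : d = 0 by apply/eqP; rewrite eq_le dn d0.
have -> : a - 2 * ((a + 1) / x) * x + ((a + 1) / x) ^+ 2 * x * 0 = - a - 2.
  by field; lra.
by lra.
Qed.

Section HilbertBasics.
Context {R : realType} {Omega : Type} {H : rkhs R Omega}.
Implicit Types (T S P : H -> H) (u v w : H).
Local Notation "<< u , v >>" := (rkhs_inner H u v).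
Local Notation Re := complex.Re.

Lemma dotDl u v w : <<u + v, w>> = <<u, w>> + <<v, w>>.
Proof. exact: linearDl. Qed.
Lemma dotDr u v w : <<w, u + v>> = <<w, u>> + <<w, v>>.
Proof. exact: linearDr. Qed.
Lemma dotNl u w : <<- u, w>> = - <<u, w>>.
Proof. exact: linearNl. Qed.
Lemma dotNr u w : <<w, - u>> = - <<w, u>>.
Proof. exact: linearNr. Qed.
Lemma dotBl u v w : <<u - v, w>> = <<u, w>> - <<v, w>>.
Proof. by rewrite dotDl dotNl. Qed.
Lemma dotBr u v w : <<w, u - v>> = <<w, u>> - <<w, v>>.
Proof. by rewrite dotDr dotNr. Qed.
Lemma dotZl (a : R[i]) u w : <<a *: u, w>> = a * <<u, w>>.
Proof. by rewrite linearZl_LR. Qed.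
Lemma dotZr (a : R[i]) u w : <<w, a *: u>> = (a^*)%C * <<w, u>>.
Proof. by rewrite linearZr_LR. Qed.
Lemma dot0l w : <<0, w>> = 0.
Proof. exact: linear0l. Qed.
Lemma dot0r w : <<w, 0>> = 0.
Proof. exact: linear0r. Qed.
Lemma dotC u v : <<u, v>> = (<<v, u>>)^*.
Proof. by rewrite (hermC (rkhs_inner H)) /= expr0 mul1r. Qed.

(** The norm of a vector, as a real number. *)
Definition vnorm u : R := Re `|u|.

Lemma vnormE u : `|u| = (vnorm u)%:C.
Proof.
have : 0 <= `|u| by [].
by rewrite /vnorm; case: `|u| => a b /ger0_Im /= ->.
Qed.

Lemma vnorm_ge0 u : 0 <= vnorm u.
Proof. by rewrite -ler0c -vnormE. Qed.

Lemma vnorm0 : vnorm 0 = 0.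
Proof. by rewrite /vnorm normr0. Qed.

Lemma vnorm_eq0 u : (vnorm u == 0) = (u == 0).
Proof. by rewrite -(inj_eq (@complexI R)) -vnormE normr_eq0. Qed.

Lemma vnorm_gt0 u : (0 < vnorm u) = (u != 0).
Proof. by rewrite lt_def vnorm_eq0 vnorm_ge0 andbT. Qed.

Lemma ler_vnormD u v : vnorm (u + v) <= vnorm u + vnorm v.
Proof. by rewrite -lecR rmorphD /= -!vnormE ler_normD. Qed.

Lemma vnormN u : vnorm (- u) = vnorm u.
Proof. by rewrite /vnorm normrN. Qed.

Lemma vnormB u v : vnorm (u - v) = vnorm (v - u).
Proof. by rewrite -vnormN opprB. Qed.

Lemma vnormZ (a : R[i]) u : vnorm (a *: u) = cabs a * vnorm u.
Proof. by apply: (@complexI R); rewrite -vnormE normrZ cabsE vnormE rmorphM. Qed.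

Lemma dotE u : <<u, u>> = (vnorm u ^+ 2)%:C.
Proof. by rewrite -rkhs_normE vnormE rmorphXn. Qed.

Lemma vnorm_sqr u : vnorm u ^+ 2 = Re <<u, u>>.
Proof. by rewrite dotE. Qed.

(** [symm T]: T is symmetric, which forces it to be linear; [qf T] is the real
    part of the quadratic form of T, and [psd T] says that it is nonnegative. *)
Definition symm T := forall u v, <<T u, v>> = <<u, T v>>.
Definition qf T u : R := Re <<T u, u>>.
Definition psd T := forall u, 0 <= qf T u.

Lemma symm_dotE T u : symm T -> <<T u, u>> = (qf T u)%:C.
Proof.
move=> sT; rewrite /qf; have := dotC (T u) u; rewrite -sT.
by case: <<_, _>> => a b [] /= e; congr (_ +i* _); lra.
Qed.

Lemma linearfD T : linear T -> forall u v, T (u + v) = T u + T v.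
Proof. by move=> l u v; have := l 1 u v; rewrite !scale1r. Qed.

Lemma linearf0 T : linear T -> T 0 = 0.
Proof. by move=> l; have := l (-1) 0 0; rewrite scaler0 add0r scaleN1r addNr. Qed.

Lemma linearfZ T : linear T -> forall (a : R[i]) u, T (a *: u) = a *: T u.
Proof. by move=> l a u; have := l a u 0; rewrite (linearf0 l) !addr0. Qed.

Lemma linearfN T : linear T -> forall u, T (- u) = - T u.
Proof. by move=> l u; rewrite -scaleN1r linearfZ// scaleN1r. Qed.

Lemma linearfB T : linear T -> forall u v, T (u - v) = T u - T v.
Proof. by move=> l u v; rewrite linearfD// linearfN. Qed.

Lemma symm_linear T : symm T -> linear T.
Proof.
move=> sT a u v; apply/eqP; rewrite -subr_eq0 -vnorm_eq0 -sqrf_eq0 vnorm_sqr.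
set w := _ - _; suff -> : <<w, w>> = 0 by [].
by rewrite {1}/w dotBl dotDl dotZl !sT dotDl dotZl subrr.
Qed.

(** Cauchy-Schwarz inequality for the semi-inner product of a positive
    operator. *)
Lemma psd_cauchy_schwarz T u v : symm T -> psd T ->
  cabs <<T u, v>> ^+ 2 <= qf T u * qf T v.
Proof.
move=> sT pT; have lT := symm_linear sT.
(* The form at u - s <T u, v> v is a quadratic polynomial in the real s. *)
apply: discriminant_le; rewrite ?sqr_ge0//.
move=> s; set b := <<T u, v>>.
have := pT (u - (s%:C * b) *: v).
rewrite /qf linearfB// linearfZ// dotBl !dotBr !dotZl !dotZr.
rewrite !symm_dotE// [in X in X -> _](_ : <<T v, u>> = b^*); last first.
  by rewrite /b dotC sT.
rewrite -/b; move: (qf T u) (qf T v) => a d.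
rewrite cabs_sqr; case: b => x y /=; congr (_ <= _); ring.
Qed.

Lemma cauchy_schwarz u v : cabs <<u, v>> <= vnorm u * vnorm v.
Proof.
rewrite -(ler_pXn2r (n := 2)) ?nnegrE ?mulr_ge0 ?vnorm_ge0 ?cabs_ge0//.
rewrite exprMn !vnorm_sqr.
by apply: (psd_cauchy_schwarz (T := id)) => // w; rewrite /qf -vnorm_sqr sqr_ge0.
Qed.

Lemma vnormD_sqr u v :
  vnorm (u + v) ^+ 2 = vnorm u ^+ 2 + vnorm v ^+ 2 + 2 * Re <<u, v>>.
Proof.
rewrite !vnorm_sqr dotDl !dotDr (dotC v u) !dotE.
by case: <<u, v>> => x y /=; ring.
Qed.

Lemma dot_inj u v : (forall w, <<w, u>> = <<w, v>>) -> u = v.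
Proof.
move=> h; apply/eqP; rewrite -subr_eq0 -vnorm_eq0 -sqrf_eq0 vnorm_sqr.
by rewrite dotBr h subrr.
Qed.

(** [opbound T K]: the operator norm of T is at most K. *)
Definition opbound T (K : R) := forall u, vnorm (T u) <= K * vnorm u.

Lemma opbound_ge0 T K : opbound T K ->
  exists2 K', 0 <= K' & opbound T K'.
Proof.
move=> h; exists `|K| => // u; apply: le_trans (h u) _.
by rewrite ler_wpM2r ?vnorm_ge0// ler_norm.
Qed.

End HilbertBasics.

(** * Riesz representation, coercive operators and adjoints *)

Section LaxMilgram.
Context {R : realType} {Omega : Type} {H : rkhs R Omega}.
Implicit Types (T S P B : H -> H) (u v w : H).
Local Notation "<< u , v >>" := (rkhs_inner H u v).
Local Notation Re := complex.Re.

Lemma bounded_operatorP T :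
  bounded_operator T <-> linear T /\ exists2 K, 0 <= K & opbound T K.
Proof.
split=> -[lT].
- move=> cT; split=> //.
  pose f : {linear H -> H} := HB.pack T (GRing.isLinear.Build _ _ _ _ T lT).
  have /linear_boundedP [M [Mr hM]] : bounded_near f (nbhs 0).
    exact/linear_bounded_continuous.
  have [m Mm] := complex_realP _ Mr.
  have /hM hm : (M < (m + 1)%:C)%R by rewrite Mm ltcR ltrDl ltr01.
  apply: (@opbound_ge0 _ _ _ _ (m + 1)) => u.
  by have := hm u; rewrite /f /= !vnormE -rmorphM lecR.
- move=> [K K0 hK].
  pose f : {linear H -> H} := HB.pack T (GRing.isLinear.Build _ _ _ _ T lT).
  split=> //; suff : continuous f by [].
  apply/linear_bounded_continuous/linear_boundedP.
  exists K%:C; split; first by apply/complex_realP; exists K.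
  move=> r Kr u; rewrite /f /=; apply: le_trans (_ : K%:C * `|u| <= _).
    by rewrite !vnormE -rmorphM lecR.
  by rewrite ler_wpM2r// ltW.
Qed.

Lemma hilbert_complete (x : nat -> H) :
  (forall e : R, 0 < e -> exists N, forall i j, (N <= i)%N -> (N <= j)%N ->
    vnorm (x i - x j) <= e) ->
  exists w, forall e : R, 0 < e -> exists N, forall n, (N <= n)%N ->
    vnorm (x n - w) <= e.
Proof.
move=> hx.
have : cvg (x @ \oo).
  apply: cauchy_cvg; apply: cauchy_exP => e e0.
  have : e \is Num.real by rewrite gtr0_real.
  move=> /complex_realP [r re]; move: e0; rewrite re ltcR => r0.
  have [|N hN] := hx (r / 2); first by rewrite divr_gt0.
  exists (x N); exists N => // n /= Nn.
  rewrite -ball_normE /= vnormE ltcR.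
  by apply: le_lt_trans (hN _ _ _ _) _ => //; lra.
move=> cx; exists (lim (x @ \oo)) => e e0.
have /cvgrPdist_le/(_ e%:C) := cx.
rewrite ltcR => /(_ e0) [N _ hN]; exists N => n Nn.
by have := hN n Nn; rewrite /= -normrN opprB vnormE lecR.
Qed.

Lemma qfD T u v : symm T -> qf T (u + v) = qf T u + qf T v + 2 * Re <<T u, v>>.
Proof.
move=> sT; rewrite /qf linearfD; last exact: symm_linear.
rewrite dotDl !dotDr (_ : <<T v, u>> = <<T u, v>>^*); last by rewrite -dotC sT.
case: (<<T u, u>>) (<<T v, v>>) (<<T u, v>>) => a b [c d] [x y] /=; ring.
Qed.

Lemma qfZ T (a : R) u : linear T -> qf T (a%:C *: u) = a ^+ 2 * qf T u.
Proof.
move=> lT; rewrite /qf linearfZ// dotZl dotZr.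
case: <<_, _>> => x y /=; ring.
Qed.

Lemma opbound_qf T K u : opbound T K -> `|qf T u| <= K * vnorm u ^+ 2.
Proof.
move=> hK; rewrite /qf; apply: le_trans (_ : cabs <<T u, u>> <= _).
  have := ler_Re_cabs (- <<T u, u>>); rewrite /cabs normrN -/(cabs _).
  have := ler_Re_cabs <<T u, u>>.
  by rewrite -normrN; case: <<_, _>> => x y /= *; rewrite ler_norml; lra.
apply: le_trans (cauchy_schwarz _ _) _.
by rewrite expr2 mulrA ler_wpM2r ?vnorm_ge0.
Qed.

(** Lax-Milgram for a symmetric coercive operator B, by minimising the
    functional u |-> <B u, u> - 2 Re f(u). With B the identity, this is the
    Riesz representation theorem. *)
Lemma lax_milgram B (c K L : R) (f : H -> R[i]) :
  symm B -> opbound B K -> 0 < c -> (forall u, c * vnorm u ^+ 2 <= qf B u) ->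
  (forall a u v, f (a *: u + v) = a * f u + f v) ->
  (forall u, cabs (f u) <= L * vnorm u) ->
  exists w, forall u, f u = <<u, B w>>.
Proof.
move=> sB hK c0 hc lf hL.
have lB := symm_linear sB.
have fD u v : f (u + v) = f u + f v by rewrite -[u]scale1r lf mul1r scale1r.
have f0 : f 0 = 0.
  by have /eqP := fD 0 0; rewrite addr0 -subr_eq0 opprD addNKr oppr_eq0 => /eqP.
have fZ a u : f (a *: u) = a * f u by rewrite -[a *: u]addr0 lf f0 addr0.
pose J u := qf B u - 2 * Re (f u).
pose E := [set J u | u in [set: H]].
have hE : has_inf E.
  split; first by exists (J 0), 0.
  exists (- (L ^+ 2 / c)) => _ [u _ <-]; rewrite /J.
  have h1 := hc u; have h2 := ler_Re_cabs (f u); have h3 := hL u.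
  apply: le_trans (_ : c * vnorm u ^+ 2 - 2 * (L * vnorm u) <= _); last by lra.
  rewrite -subr_ge0.
  have -> : c * vnorm u ^+ 2 - 2 * (L * vnorm u) - - (L ^+ 2 / c) =
     (c * vnorm u - L) ^+ 2 / c by field; lra.
  by rewrite divr_ge0 ?sqr_ge0// ltW.
set m := inf E.
have mJ u : m <= J u by apply: ge_inf; [exact: (proj2 hE)|exists u].
have hx n : {u | J u <= m + n.+1%:R^-1}.
  apply: cid; have [|_ [u _ <-] hu] := inf_adherent (_ : 0 < n.+1%:R^-1) hE.
    by rewrite invr_gt0.
  by exists u; apply: ltW.
pose x n := sval (hx n).
have xJ n : J (x n) <= m + n.+1%:R^-1 by exact: svalP (hx n).
(* The parallelogram identity makes the minimising sequence x Cauchy. *)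
have dist i j : c * vnorm (x i - x j) ^+ 2 <= 2 * i.+1%:R^-1 + 2 * j.+1%:R^-1.
  apply: le_trans (hc _) _.
  have h := mJ ((2^-1 : R)%:C *: (x i + x j)).
  move: h (xJ i) (xJ j); rewrite /J qfZ// fZ fD qfD// (qfD _ (- x j))//.
  have -> : qf B (- x j) = qf B (x j).
    by rewrite -scaleN1r -[-1]/(- 1%:C) -rmorphN qfZ// sqrrN expr1n mul1r.
  have -> : Re <<B (x i), - x j>> = - Re <<B (x i), x j>>.
    by rewrite dotNr; case: <<_, _>>.
  have -> : Re ((2^-1)%:C * (f (x i) + f (x j))) = 2^-1 * (Re (f (x i)) + Re (f (x j))).
    by case: (f (x i)) (f (x j)) => a b [a' b'] /=; ring.
  by rewrite exprVn; move: (i.+1%:R^-1) (j.+1%:R^-1) => ? ?; lra.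
have [|w hw] := @hilbert_complete x.
  move=> e e0.
  have ce : 0 < c * e ^+ 2 / 4 by rewrite !mulr_gt0// ?exprn_gt0// invr_gt0.
  have [N _ hN] := near_infty_natSinv_lt (PosNum ce).
  exists N => i j Ni Nj.
  rewrite -(ler_pXn2r (n := 2)) ?nnegrE ?vnorm_ge0 ?(ltW e0)//.
  rewrite -(ler_pM2l c0); apply: le_trans (dist i j) _.
  have /= := hN i Ni; have /= := hN j Nj.
  by move: (i.+1%:R^-1) (j.+1%:R^-1) => ? ?; lra.
(* First variation: J >= m on the line through x n directed by v, and
   J (x n) <= m + 1 / (n + 1). *)
have var v n : (Re <<B (x n), v>> - Re (f v)) ^+ 2 <= n.+1%:R^-1 * qf B v.
  set X := _ - _; apply: discriminant_le; rewrite ?sqr_ge0 ?invr_ge0//.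
    by apply: le_trans (hc v); rewrite mulr_ge0 ?sqr_ge0 ?ltW.
  move=> s; have := mJ (x n + (- (s * X))%:C *: v); have := xJ n.
  rewrite /J qfD// qfZ// fD fZ dotZr.
  have -> : Re ((- (s * X))%:C^* * <<B (x n), v>>) = - (s * X) * Re <<B (x n), v>>.
    by case: <<_, _>> => a b /=; ring.
  have -> : Re (f (x n) + (- (s * X))%:C * f v) = Re (f (x n)) - s * X * Re (f v).
    by case: (f (x n)) (f v) => a b [a' b'] /=; ring.
  move: (n.+1%:R^-1) => N h1 h2.
  have -> : N - 2 * s * X ^+ 2 + s ^+ 2 * X ^+ 2 * qf B v =
     N - 2 * (s * X) * (Re <<B (x n), v>> - Re (f v)) + (s * X) ^+ 2 * qf B v.
    by rewrite -/X; ring.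
  by lra.
have key v : Re <<B w, v>> = Re (f v).
  apply/eqP; rewrite -subr_eq0 -normr_le0; apply/ler_addgt0Pl => e e0; rewrite addr0.
  have [K' K'0 hK'] := opbound_ge0 hK.
  have d0 : 0 < e / 2 / (K' * vnorm v + 1).
    by rewrite !divr_gt0// ltr_wpDl// mulr_ge0// vnorm_ge0.
  have [N hN] := hw _ d0.
  have q0 : 0 <= qf B v by apply: le_trans (hc v); rewrite mulr_ge0 ?sqr_ge0 ?ltW.
  have ce : 0 < (e / 2) ^+ 2 / (qf B v + 1).
    by rewrite divr_gt0// ?exprn_gt0 ?divr_gt0// ltr_wpDl.
  have [M _ hM] := near_infty_natSinv_lt (PosNum ce).
  pose n := maxn N M.
  have h1 : `|Re <<B w, v>> - Re <<B (x n), v>>| <= e / 2.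
    have -> : Re <<B w, v>> - Re <<B (x n), v>> = Re <<B (w - x n), v>>.
      by rewrite linearfB// dotBl; case: (<<B w, v>>) (<<B (x n), v>>) => a b [].
    apply: le_trans (_ : cabs <<B (w - x n), v>> <= _).
      have := ler_Re_cabs (- <<B (w - x n), v>>); rewrite /cabs normrN -/(cabs _).
      have := ler_Re_cabs <<B (w - x n), v>>.
      by case: <<_, _>> => a b /= *; rewrite ler_norml; lra.
    apply: le_trans (cauchy_schwarz _ _) _.
    apply: le_trans (_ : K' * vnorm (x n - w) * vnorm v <= _).
      by rewrite ler_wpM2r ?vnorm_ge0// -vnormB.
    apply: le_trans (_ : (K' * vnorm v + 1) * vnorm (x n - w) <= _).
      by rewrite mulrAC ler_wpM2r ?vnorm_ge0// lerDl.
    rewrite mulrC -ler_pdivlMr ?hN ?leq_maxl//.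
    by rewrite ltr_wpDl// mulr_ge0// vnorm_ge0.
  have h2 : `|Re <<B (x n), v>> - Re (f v)| <= e / 2.
    rewrite -(ler_pXn2r (n := 2)) ?nnegrE ?divr_ge0 ?(ltW e0)//.
    rewrite real_normK ?num_real//; apply: le_trans (var v n) _.
    have /= := hM n (leq_maxr _ _).
    rewrite ltr_pdivlMr ?ltr_wpDl// mulrDr mulr1 => h.
    by apply: le_trans (ltW h); rewrite lerDl invr_ge0.
  have := ler_normD (Re <<B w, v>> - Re <<B (x n), v>>) (Re <<B (x n), v>> - Re (f v)).
  by rewrite addrA subrK; lra.
exists w => v; rewrite dotC.
have := key v; have := key ('i *: v); rewrite dotZr fZ.
by case: <<_, _>> (f v) => a b [a' b'] /= h1 h2; congr (_ +i* _); lra.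
Qed.

Lemma riesz_representation (L : R) (f : H -> R[i]) :
  (forall a u v, f (a *: u + v) = a * f u + f v) ->
  (forall u, cabs (f u) <= L * vnorm u) ->
  exists w, forall u, f u = <<u, w>>.
Proof.
move=> lf hL.
have [||||w hw] := @lax_milgram id 1 1 L f _ _ _ _ lf hL => //; last by exists w.
- by move=> u; rewrite mul1r.
- by move=> u; rewrite mul1r /qf vnorm_sqr.
Qed.

(** The inverse is obtained from the functionals <_, v>. *)
Lemma coercive_inverse B (c K : R) :
  symm B -> opbound B K -> 0 < c -> (forall u, c * vnorm u ^+ 2 <= qf B u) ->
  exists S, [/\ bounded_operator S, cancel B S & cancel S B].
Proof.
move=> sB hK c0 hc; have lB := symm_linear sB.
have hS v : {w | B w = v}.
  apply: cid.
  have [||w hw] := @lax_milgram B c K (vnorm v) (fun u => <<u, v>>) sB hK c0 hc.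
  - by move=> a u u'; rewrite dotDl dotZl.
  - by move=> u; rewrite mulrC cauchy_schwarz.
  by exists w; apply: dot_inj => u; rewrite hw.
pose S v := sval (hS v).
have BS : cancel S B by move=> v; exact: svalP (hS v).
have bB u : c * vnorm u <= vnorm (B u).
  have [->|u0] := eqVneq u 0; first by rewrite vnorm0 mulr0 vnorm_ge0.
  rewrite -(@ler_pM2r _ (vnorm u)) ?vnorm_gt0// -mulrA -expr2.
  by apply: le_trans (hc u) (le_trans (ler_Re_cabs _) (cauchy_schwarz _ _)).
have Binj : injective B.
  move=> u v e; apply/eqP; rewrite -subr_eq0 -vnorm_eq0 eq_le vnorm_ge0 andbT.
  rewrite -(ler_pM2l c0) mulr0; apply: le_trans (bB _) _.
  by rewrite linearfB// e subrr vnorm0.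
have SB : cancel B S by move=> u; apply: Binj; rewrite BS.
exists S; split=> //; apply/bounded_operatorP; split.
  by move=> a u v; apply: Binj; rewrite lB !BS.
exists c^-1; rewrite ?invr_ge0 ?ltW// => u.
by rewrite ler_pdivlMl//; apply: le_trans (bB _) _; rewrite BS.
Qed.

Lemma adjointE T : bounded_operator T -> forall u v, <<T u, v>> = <<u, adjoint T v>>.
Proof.
move=> /bounded_operatorP [lT [K K0 hK]] u v.
apply: (@xgetPex _ 0 [set w | forall u, <<T u, v>> = <<u, w>>]).
apply: (@riesz_representation (K * vnorm v)) => [a x y|x].
  by rewrite lT dotDl dotZl.
apply: le_trans (cauchy_schwarz _ _) _.
by rewrite mulrAC ler_wpM2r ?vnorm_ge0.
Qed.

Lemma adjoint_bounded T : bounded_operator T -> bounded_operator (adjoint T).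
Proof.
move=> bT; have hT := adjointE bT; case/bounded_operatorP: bT => lT [K K0 hK].
apply/bounded_operatorP; split.
  by move=> a u v; apply: dot_inj => w; rewrite dotDr dotZr -!hT dotDr dotZr.
exists K => // v; have [->|v0] := eqVneq (adjoint T v) 0.
  by rewrite vnorm0 mulr_ge0 ?vnorm_ge0.
rewrite -(@ler_pM2r _ (vnorm (adjoint T v))) ?vnorm_gt0// -expr2 vnorm_sqr -hT.
apply: le_trans (ler_Re_cabs _) (le_trans (cauchy_schwarz _ _) _).
by rewrite mulrAC ler_wpM2r ?vnorm_ge0.
Qed.

Lemma adjointK T : bounded_operator T -> adjoint (adjoint T) = T.
Proof.
move=> bT; have bA := adjoint_bounded bT.
apply/funext => u; apply: dot_inj => v.
by rewrite -(adjointE bA) dotC -(adjointE bT) -dotC.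
Qed.

End LaxMilgram.

(** * Polynomials in an operator and its spectrum *)

Section PolynomialCalculus.
Context {R : realType} {Omega : Type} {H : rkhs R Omega}.
Implicit Types (T S P B Q : H -> H) (u v w : H) (p q : {poly R[i]}).
Local Notation "<< u , v >>" := (rkhs_inner H u v).
Local Notation Re := complex.Re.
Local Notation Im := complex.Im.

Lemma bounded_linear T : bounded_operator T -> linear T.
Proof. by case. Qed.

Lemma bounded_id : bounded_operator (@idfun H).
Proof. by apply/bounded_operatorP; split=> //; exists 1 => // u; rewrite mul1r. Qed.

Lemma bounded_comp T S :
  bounded_operator T -> bounded_operator S -> bounded_operator (T \o S).
Proof.
move=> /bounded_operatorP [lT [K K0 hK]] /bounded_operatorP [lS [L L0 hL]].
apply/bounded_operatorP; split; first by move=> a u v; rewrite /= lS lT.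
exists (K * L); first exact: mulr_ge0.
by move=> u /=; apply: le_trans (hK _) _; rewrite -mulrA ler_wpM2l.
Qed.

Lemma bounded_add T S :
  bounded_operator T -> bounded_operator S -> bounded_operator (T \+ S).
Proof.
move=> /bounded_operatorP [lT [K K0 hK]] /bounded_operatorP [lS [L L0 hL]].
apply/bounded_operatorP; split.
  by move=> a u v; rewrite /= lS lT scalerDr addrACA.
exists (K + L); first exact: addr_ge0.
move=> u /=; apply: le_trans (ler_vnormD _ _) _.
by rewrite mulrDl lerD.
Qed.

Lemma bounded_scale (a : R[i]) T :
  bounded_operator T -> bounded_operator (fun u => a *: T u).
Proof.
move=> /bounded_operatorP [lT [K K0 hK]].
apply/bounded_operatorP; split.
  by move=> b u v; rewrite lT scalerDr !scalerA mulrC.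
exists (cabs a * K); first by rewrite mulr_ge0 ?cabs_ge0.
by move=> u; rewrite vnormZ -mulrA ler_wpM2l ?cabs_ge0.
Qed.

Lemma bounded_sub T S :
  bounded_operator T -> bounded_operator S -> bounded_operator (T \- S).
Proof.
move=> bT /(bounded_scale (-1)) /(bounded_add bT); congr bounded_operator.
by apply/funext => u /=; rewrite scaleN1r.
Qed.

(** Polynomials with complex coefficients in an operator; they are needed to
    factor real polynomials. *)
Definition cpoly_op (q : {poly R[i]}) T u := \sum_(i < size q) q`_i *: iter i T u.

Lemma cpoly_op_widen n q T u : (size q <= n)%N ->
  cpoly_op q T u = \sum_(i < n) q`_i *: iter i T u.
Proof.
move=> qn; rewrite /cpoly_op (big_ord_widen _ (fun i => q`_i *: iter i T u) qn).
rewrite big_mkcond; apply: eq_bigr => i _.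
by case: ltnP => // h; rewrite nth_default// scale0r.
Qed.

Lemma cpoly_opD p q T u : cpoly_op (p + q) T u = cpoly_op p T u + cpoly_op q T u.
Proof.
pose n := maxn (size p) (size q).
rewrite !(@cpoly_op_widen n) ?leq_maxl ?leq_maxr ?size_polyD//.
by rewrite -big_split; apply: eq_bigr => i _; rewrite coefD scalerDl.
Qed.

Lemma cpoly_opZ a q T u : cpoly_op (a *: q) T u = a *: cpoly_op q T u.
Proof.
rewrite (@cpoly_op_widen (size q)) ?size_scale_leq// scaler_sumr.
by apply: eq_bigr => i _; rewrite coefZ scalerA.
Qed.

Lemma cpoly_op0 T u : cpoly_op 0 T u = 0.
Proof. by rewrite -(scale0r 0) cpoly_opZ scale0r. Qed.

Lemma cpoly_opC a T u : cpoly_op a%:P T u = a *: u.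
Proof.
by rewrite (@cpoly_op_widen 1) ?size_polyC_leq1// big_ord1 coefC.
Qed.

Lemma cpoly_opMX q T u : cpoly_op (q * 'X) T u = cpoly_op q T (T u).
Proof.
rewrite (@cpoly_op_widen (size q).+1).
  rewrite big_ord_recl coefMX /= scale0r add0r; apply: eq_bigr => i _.
  by rewrite coefMX /= -iterSr.
by have [->|q0] := eqVneq q 0; rewrite ?mul0r ?size_poly0// size_mulX.
Qed.

Lemma cpoly_op_linear q T : linear T -> linear (cpoly_op q T).
Proof.
move=> lT; have li i : linear (iter i T).
  by elim: i => [|i IH] a u v //; rewrite !iterS IH lT.
move=> a u v; rewrite /cpoly_op scaler_sumr -big_split; apply: eq_bigr => i _.
by rewrite li scalerDr !scalerA mulrC.
Qed.

Lemma cpoly_op_comm q T S u : linear S -> (forall v, T (S v) = S (T v)) ->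
  cpoly_op q T (S u) = S (cpoly_op q T u).
Proof.
move=> lS TS; elim/poly_ind: q u => [|q c IH] u; first by rewrite !cpoly_op0 linearf0.
by rewrite !cpoly_opD !cpoly_opMX !cpoly_opC TS IH (linearfD lS) (linearfZ lS).
Qed.

Lemma cpoly_opM p q T u : linear T ->
  cpoly_op (p * q) T u = cpoly_op p T (cpoly_op q T u).
Proof.
move=> lT; elim/poly_ind: p u => [|p c IH] u; first by rewrite mul0r !cpoly_op0.
rewrite mulrDl !cpoly_opD !cpoly_opMX mul_polyC cpoly_opZ cpoly_opC.
by rewrite mulrAC cpoly_opMX IH (cpoly_op_comm _ _ lT).
Qed.

Lemma cpoly_op_intertwine q T S B : linear B -> (forall v, B (T v) = S (B v)) ->
  forall u, B (cpoly_op q T u) = cpoly_op q S (B u).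
Proof.
move=> lB BT u; elim/poly_ind: q u => [|q c IH] u; first by rewrite !cpoly_op0 linearf0.
by rewrite !cpoly_opD !cpoly_opMX !cpoly_opC (linearfD lB) (linearfZ lB) IH BT.
Qed.

Lemma bounded_cpoly_op q T : bounded_operator T -> bounded_operator (cpoly_op q T).
Proof.
move=> bT; elim/poly_ind: q => [|q c IH].
  have -> : cpoly_op 0 T = (fun u => (0 : R[i]) *: u).
    by apply/funext => u; rewrite cpoly_op0 scale0r.
  exact: (bounded_scale 0 bounded_id).
have -> : cpoly_op (q * 'X + c%:P) T = (cpoly_op q T \o T) \+ (fun u => c *: u).
  by apply/funext => u /=; rewrite cpoly_opD cpoly_opMX cpoly_opC.
apply: bounded_add; [exact: bounded_comp|exact: (bounded_scale c bounded_id)].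
Qed.

(** T has a bounded two-sided inverse. *)
Definition invertible T :=
  exists S, [/\ bounded_operator S, cancel T S & cancel S T].

Lemma spectrumP T (z : R[i]) : ~ spectrum T z <-> invertible (fun u => T u - z *: u).
Proof.
split=> [/contrapT|] [S [bS S1 S2]]; first by exists S.
by apply; exists S.
Qed.

Lemma invertible_comp T S : invertible T -> invertible S -> invertible (T \o S).
Proof.
move=> [T' [bT T1 T2]] [S' [bS S1 S2]]; exists (S' \o T'); split.
- exact: bounded_comp.
- exact: can_comp.
- exact: can_comp.
Qed.

Lemma invertible_scale (a : R[i]) T : a != 0 -> linear T -> invertible T ->
  invertible (fun u => a *: T u).
Proof.
move=> a0 lT [S [bS S1 S2]]; have lS := bounded_linear bS.
exists (fun u => a^-1 *: S u); split; first exact: bounded_scale.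
- by move=> u; rewrite linearfZ// S1 scalerA mulVf// scale1r.
- by move=> u; rewrite linearfZ// S2 scalerA divff// scale1r.
Qed.

(** The inclusion of the spectrum of q(T) in the image by q of the spectrum of
    T, from the factorization of q into linear terms. *)
Lemma cpoly_op_invertible q T : bounded_operator T -> q != 0 ->
  (forall z, root q z -> ~ spectrum T z) -> invertible (cpoly_op q T).
Proof.
move=> bT q0; have lT := bounded_linear bT.
have [r qr] := closed_field_poly_normal q; rewrite {}qr.
have lq0 : lead_coef q != 0 by rewrite lead_coef_eq0.
move: (lead_coef q) lq0 => c c0 {q q0} hr.
have -> : cpoly_op (c *: \prod_(z <- r) ('X - z%:P)) T =
    (fun u => c *: cpoly_op (\prod_(z <- r) ('X - z%:P)) T u).
  by apply/funext => u; rewrite cpoly_opZ.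
apply: invertible_scale => //; first exact: cpoly_op_linear.
have {}hr z : z \in r -> ~ spectrum T z.
  by move=> zr; apply: hr; rewrite rootZ// root_prod_XsubC.
elim: r hr => [|z r IH] hr.
  rewrite big_nil (_ : cpoly_op 1 T = idfun); last first.
    by apply/funext => u; rewrite cpoly_opC scale1r.
  by exists idfun; split=> //; exact: bounded_id.
rewrite big_cons (_ : cpoly_op _ T =
   (fun u => T u - z *: u) \o cpoly_op (\prod_(z <- r) ('X - z%:P)) T).
  apply: invertible_comp.
    by apply/spectrumP/hr; rewrite mem_head.
  by apply: IH => y yr; apply: hr; rewrite in_cons yr orbT.
apply/funext => u; rewrite /= cpoly_opM// cpoly_opD -polyCN cpoly_opC scaleNr.
by rewrite -['X]mul1r cpoly_opMX cpoly_opC scale1r.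
Qed.

Lemma invertible_one_sided T S S' : bounded_operator S -> cancel T S ->
  cancel S' T -> invertible T.
Proof.
move=> bS TS S'T; exists S; split=> // v.
by have := TS (S' v); rewrite S'T => ->; rewrite S'T.
Qed.

Lemma spectrum_real T (z : R[i]) : bounded_operator T -> symm T ->
  spectrum T z -> Im z = 0.
Proof.
move=> bT sT; apply: contraPP => z0; apply/spectrumP.
have lT := bounded_linear bT.
pose T1 u := T u - z *: u; pose T2 u := T u - z^* *: u.
have bz (a : R[i]) : bounded_operator (fun u => T u - a *: u).
  exact: (bounded_sub bT (bounded_scale a bounded_id)).
have T12 u v : <<T1 u, v>> = <<u, T2 v>>.
  rewrite /T1 /T2 dotBl dotBr dotZl dotZr sT.
  by rewrite conjcK.
have T21 u v : <<T2 u, v>> = <<u, T1 v>>.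
  by rewrite dotC -T12 -dotC.
have comm u : T1 (T2 u) = T2 (T1 u).
  rewrite /T1 /T2 !(linearfB lT) !(linearfZ lT) !scalerBr !scalerA [z^* * z]mulrC.
  by rewrite !opprB !addrA addrAC [RHS]addrAC; congr (_ + _); rewrite addrAC.
have sB : symm (T1 \o T2) by move=> u v; rewrite /= T12 T21 comm.
(* (T - z)(T - z^* ) = (T - Re z)^2 + (Im z)^2 is coercive. *)
have hB u : Im z ^+ 2 * vnorm u ^+ 2 <= qf (T1 \o T2) u.
  rewrite /qf /= T12 -vnorm_sqr.
  have -> : T2 u = (T u - (Re z)%:C *: u) + 'i * (Im z)%:C *: u.
    rewrite /T2 -addrA -scaleNr -[in RHS]scaleNr -scalerDl; congr (_ + _ *: _).
    by case: (z) => a b; simpc.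
  set X := T u - _; rewrite vnormD_sqr vnormZ exprMn.
  have -> : cabs ('i * (Im z)%:C : R[i]) ^+ 2 = Im z ^+ 2.
    by rewrite cabs_sqr /=; case: (z) => a b /=; ring.
  rewrite dotZr (_ : Re _ = 0); first by rewrite mulr0 addr0 lerDr sqr_ge0.
  have : <<X, u>> = (qf T u - Re z * vnorm u ^+ 2)%:C.
    by rewrite /X dotBl dotZl dotE symm_dotE// -rmorphM -rmorphB.
  by move=> ->; case: (z) => a b /=; ring.
have bB : bounded_operator (T1 \o T2) by apply: bounded_comp; exact: bz.
have [lB [K K0 hK]] := (bounded_operatorP _).1 bB.
have [|S [bS S1 S2]] := coercive_inverse sB hK _ hB.
  by rewrite exprn_even_gt0//=; apply/eqP.
apply: (@invertible_one_sided _ (S \o T2) (T2 \o S)).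
- by apply: bounded_comp => //; exact: bz.
- by move=> u /=; rewrite -comm; exact: S1.
- by move=> u; exact: S2.
Qed.

(** Below a lower bound m of the quadratic form, T - r is coercive. *)
Lemma spectrum_ge T (m r : R) : bounded_operator T -> symm T ->
  (forall u, m * vnorm u ^+ 2 <= qf T u) -> spectrum T r%:C -> m <= r.
Proof.
move=> bT sT hm; apply: contraPT; rewrite -ltNge => rm; apply/spectrumP.
set B := fun u => _; have bB : bounded_operator B.
  exact: (bounded_sub bT (bounded_scale _ bounded_id)).
have sB : symm B.
  by move=> u v; rewrite /B dotBl dotBr dotZl dotZr sT conjc_real.
have [lB [K K0 hK]] := (bounded_operatorP _).1 bB.
apply: (@coercive_inverse _ _ _ B (m - r) K) => //; first by rewrite subr_gt0.
move=> u; have := hm u; rewrite /qf /B dotBl dotZl dotE.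
by case: <<_, _>> => a b /=; lra.
Qed.

(** Above an upper bound m of the quadratic form, r - T is coercive. *)
Lemma spectrum_le T (m r : R) : bounded_operator T -> symm T ->
  (forall u, qf T u <= m * vnorm u ^+ 2) -> spectrum T r%:C -> r <= m.
Proof.
move=> bT sT hm; apply: contraPT; rewrite -ltNge => rm; apply/spectrumP.
set B := fun u => _; have bB : bounded_operator B.
  exact: (bounded_sub bT (bounded_scale _ bounded_id)).
have bN := bounded_scale (-1) bB.
have sB : symm (fun u => -1 *: B u).
  move=> u v; rewrite /B dotZl dotZr dotBl dotBr dotZl dotZr sT conjc_real.
  by rewrite rmorphN rmorph1.
have [lN [K K0 hK]] := (bounded_operatorP _).1 bN.
have [||S [bS S1 S2]] := @coercive_inverse _ _ _ _ (r - m) K sB hK.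
  by rewrite subr_gt0.
  move=> u; have := hm u; rewrite /qf /B dotZl dotBl dotZl dotE.
  by case: <<_, _>> => a b /=; lra.
have lB := bounded_linear bB.
apply: (@invertible_one_sided _ (fun u => S (-1 *: u)) (fun u => -1 *: S u)).
- exact: (bounded_comp bS (bounded_scale _ bounded_id)).
- by move=> u; exact: S1.
- by move=> u; rewrite (linearfZ lB); exact: S2.
Qed.

(** The infimum of the quadratic form on the unit sphere belongs to the
    spectrum. *)
Lemma spectrum_inf B (u0 : H) : bounded_operator B -> symm B -> u0 != 0 ->
  exists2 m : R, (forall u, m * vnorm u ^+ 2 <= qf B u) & spectrum B m%:C.
Proof.
move=> bB sB u00; have [lB [K K0 hK]] := (bounded_operatorP _).1 bB.
have n0 : 0 < vnorm u0 ^+ 2 by rewrite exprn_gt0// vnorm_gt0.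
pose E := [set m : R | forall u, m * vnorm u ^+ 2 <= qf B u].
have hE : has_sup E.
  split.
    exists (- K) => u; have := opbound_qf u hK; rewrite ler_norml => /andP[h _].
    by rewrite mulNr.
  exists (qf B u0 / vnorm u0 ^+ 2) => m /(_ u0).
  by rewrite ler_pdivlMr.
pose m := sup E; have Em : E m.
  move=> u; apply/ler_addgt0Pr => e e0.
  have d0 : 0 < e / (vnorm u ^+ 2 + 1) by rewrite divr_gt0// ltr_wpDl ?sqr_ge0.
  have [m' Em' hm'] := sup_adherent d0 hE.
  rewrite -lerBlDr; apply: le_trans (Em' u).
  rewrite lerBlDr -lerBlDl -mulrBl.
  apply: le_trans (_ : e / (vnorm u ^+ 2 + 1) * vnorm u ^+ 2 <= _).
    by rewrite ler_wpM2r ?sqr_ge0// lerBlDl -lerBlDr ltW.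
  by rewrite mulrAC ler_pdivrMr ?ltr_wpDl ?sqr_ge0// ler_wpM2l ?(ltW e0)// lerDl.
exists m => //; apply: contrapT => /spectrumP [S [bS S1 S2]].
have [lS [L L0 hL]] := (bounded_operatorP _).1 bS.
set C := (fun u => B u - m%:C *: u) in S1 S2.
have bC : bounded_operator C.
  exact: (bounded_sub bB (bounded_scale _ bounded_id)).
have sC : symm C.
  by move=> u v; rewrite /C dotBl dotBr dotZl dotZr sB conjc_real.
have qC u : qf C u = qf B u - m * vnorm u ^+ 2.
  rewrite /qf /C dotBl dotZl dotE; case: <<_, _>> => a b /=; ring.
have pC : psd C by move=> u; rewrite qC subr_ge0.
have [lC [M M0 hM]] := (bounded_operatorP _).1 bC.
(* Cauchy-Schwarz for <C _, _> bounds |C u|^2 by M <C u, u>; as C has a bounded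
   inverse, C is coercive, so that m can be increased. *)
have hC u : vnorm (C u) ^+ 2 <= M * qf C u.
  have [e|n1] := eqVneq (vnorm (C u)) 0.
    by rewrite e expr0n mulr_ge0.
  have h := psd_cauchy_schwarz u (C u) sC pC.
  have h2 : qf C (C u) <= M * vnorm (C u) ^+ 2.
    by apply: le_trans (ler_norm _) (opbound_qf _ hM).
  have n2 : 0 < vnorm (C u) ^+ 2 by rewrite exprn_gt0// lt_def n1 vnorm_ge0.
  rewrite -(ler_pM2r n2); apply: le_trans (_ : qf C u * qf C (C u) <= _).
    by apply: le_trans h; rewrite dotE cabsR real_normK ?num_real.
  by rewrite [M * _]mulrC -mulrA ler_wpM2l.
pose d := (L ^+ 2 * M + 1)^-1.
have d0 : 0 < d by rewrite invr_gt0 ltr_wpDl// mulr_ge0 ?sqr_ge0.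
suff : E (m + d) by move=> /(sup_upper_bound hE); rewrite -/m; lra.
move=> u; rewrite mulrDl -lerBrDl -qC /d ler_pdivrMl ?ltr_wpDl ?mulr_ge0 ?sqr_ge0//.
rewrite mulrDl mul1r; apply: le_trans (_ : L ^+ 2 * M * qf C u <= _); last first.
  by rewrite lerDl pC.
apply: le_trans (_ : L ^+ 2 * vnorm (C u) ^+ 2 <= _).
  rewrite -exprMn ler_pXn2r ?nnegrE ?mulr_ge0 ?vnorm_ge0//.
  by have := hL (C u); rewrite S1.
by rewrite -mulrA ler_wpM2l ?sqr_ge0.
Qed.

End PolynomialCalculus.

Section RealPolynomialCalculus.
Context {R : realType} {Omega : Type} {H : rkhs R Omega}.
Implicit Types (T S P B Q : H -> H) (u v w : H) (p q : {poly R}).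
Local Notation "<< u , v >>" := (rkhs_inner H u v).

Lemma poly_opE (p : {poly R}) T u :
  poly_op p T u = cpoly_op (map_poly (real_complex R) p) T u.
Proof.
rewrite /poly_op /cpoly_op size_map_poly; apply: eq_bigr => i _.
by rewrite coef_map.
Qed.

Lemma poly_opD p q T u : poly_op (p + q) T u = poly_op p T u + poly_op q T u.
Proof. by rewrite !poly_opE rmorphD cpoly_opD. Qed.

Lemma poly_opM p q T u : linear T ->
  poly_op (p * q) T u = poly_op p T (poly_op q T u).
Proof. by move=> lT; rewrite !poly_opE rmorphM cpoly_opM. Qed.

Lemma poly_opC c T u : poly_op c%:P T u = c%:C *: u.
Proof. by rewrite poly_opE map_polyC cpoly_opC. Qed.

Lemma poly_opX T u : poly_op 'X T u = T u.
Proof.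
by rewrite poly_opE map_polyX -['X]mul1r cpoly_opMX cpoly_opC scale1r.
Qed.

Lemma poly_opB p q T u : poly_op (p - q) T u = poly_op p T u - poly_op q T u.
Proof.
rewrite -mulN1r -[-1]/(- 1%:P) -polyCN mul_polyC poly_opD; congr (_ + _).
by rewrite !poly_opE map_polyZ cpoly_opZ rmorphN rmorph1 scaleN1r.
Qed.

Lemma bounded_poly_op p T : bounded_operator T -> bounded_operator (poly_op p T).
Proof.
move=> bT; rewrite (_ : poly_op p T = cpoly_op (map_poly (real_complex R) p) T).
  exact: bounded_cpoly_op.
by apply/funext => u; rewrite poly_opE.
Qed.

Lemma poly_op_intertwine p T S B : linear B -> (forall v, B (T v) = S (B v)) ->
  forall u, B (poly_op p T u) = poly_op p S (B u).
Proof. by move=> lB h u; rewrite !poly_opE (cpoly_op_intertwine _ lB h). Qed.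

Lemma symm_poly_op p T : symm T -> symm (poly_op p T).
Proof.
move=> sT; have lT := symm_linear sT.
elim/poly_ind: p => [|p c IH] u v.
  by rewrite -polyC0 !poly_opC !scale0r dot0l dot0r.
rewrite !poly_opD !poly_opM// !poly_opC !poly_opX dotDl dotDr dotZl dotZr IH sT.
rewrite conjc_real; congr (<<_, _>> + _).
by rewrite (poly_op_intertwine (S := T) _ lT).
Qed.

(** Positivity of the polynomial calculus: if p >= 0 on the spectrum of T then
    p(T) >= 0. Indeed the infimum m of the quadratic form of p(T) is in the
    spectrum of p(T), so that p - m has a root r in the spectrum of T, and
    m = p(r) >= 0. *)
Lemma psd_poly_op p T : bounded_operator T -> symm T ->
  (forall r, spectrum T r%:C -> 0 <= p.[r]) -> psd (poly_op p T).
Proof.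
move=> bT sT hp u; have [->|u0] := eqVneq u 0.
  by rewrite /qf dot0r.
have lT := bounded_linear bT.
have bp := bounded_poly_op p bT; have sp := symm_poly_op p sT.
have [m hm ms] := spectrum_inf bp sp u0.
apply: le_trans (hm u); rewrite mulr_ge0 ?sqr_ge0//.
have [e|pm] := eqVneq p m%:P.
  (* p is constant: the spectrum of T is not empty. *)
  have [r _ rs] := spectrum_inf bT sT u0.
  by have := hp _ rs; rewrite e hornerC.
pose q := map_poly (real_complex R) (p - m%:P).
have q0 : q != 0 by rewrite map_poly_eq0 subr_eq0.
have [z rz zs] : exists2 z, root q z & spectrum T z.
  apply: contrapT => h; move: ms; apply/spectrumP.
  suff : invertible (cpoly_op q T).
    congr invertible; apply/funext => v.
    by rewrite -poly_opE poly_opB poly_opC.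
  by apply: cpoly_op_invertible => // z rz zs; apply: h; exists z.
have := spectrum_real bT sT zs.
case: z rz zs => r i /= rz zs i0; rewrite i0 in rz zs.
have : root (p - m%:P) r by rewrite -(fmorph_root (real_complex R)).
rewrite /root hornerD hornerN hornerC subr_eq0 => /eqP <-.
exact: hp.
Qed.

(** Positivity of e^2 - p(T)^2 bounds the norm of p(T) by any bound e of |p| on
    the spectrum of T. *)
Lemma opbound_poly_op p T e : bounded_operator T -> symm T -> 0 <= e ->
  (forall r, spectrum T r%:C -> `|p.[r]| <= e) -> opbound (poly_op p T) e.
Proof.
move=> bT sT e0 hp u; have lT := bounded_linear bT.
rewrite -(ler_pXn2r (n := 2)) ?nnegrE ?mulr_ge0 ?vnorm_ge0// exprMn.
have : psd (poly_op ((e ^+ 2)%:P - p * p) T).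
  apply: psd_poly_op => // r /hp; rewrite !hornerE -expr2 subr_ge0 => h.
  by rewrite -[_ ^+ 2]real_normK ?num_real// ler_pXn2r ?nnegrE.
move=> /(_ u); rewrite /qf poly_opB poly_opC poly_opM// dotBl dotZl.
rewrite (symm_poly_op p sT (poly_op p T u)) !dotE -rmorphM -rmorphB /=.
by rewrite subr_ge0.
Qed.

End RealPolynomialCalculus.

(** * The Weierstrass approximation theorem *)

Section Bernstein.
Context {R : realType}.
Implicit Types (f g : R -> R) (F G : nat -> R).

(** The polynomial whose value at x is the expectation of F at the number of
    successes in n independent trials of probability x. *)
Fixpoint bernstein n F : {poly R} :=
  if n is n'.+1 then (1 - 'X) * bernstein n' F + 'X * bernstein n' (F \o S)
  else (F 0%N)%:P.

Lemma bernsteinS n F x : (bernstein n.+1 F).[x] =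
  (1 - x) * (bernstein n F).[x] + x * (bernstein n (F \o S)).[x].
Proof. by rewrite /= !hornerE. Qed.

Lemma ler_bernstein n F G x : 0 <= x <= 1 ->
  (forall k, (k <= n)%N -> F k <= G k) -> (bernstein n F).[x] <= (bernstein n G).[x].
Proof.
move=> /andP[x0 x1]; elim: n F G => [|n IH] F G FG.
  by rewrite /= !hornerC FG.
rewrite !bernsteinS lerD// ler_wpM2l ?subr_ge0//; apply: IH => k kn.
  by apply: FG; rewrite ltnW.
exact: FG.
Qed.

(** The expectation of a quadratic function, which encodes the first two moments
    of the binomial distribution. *)
Lemma bernstein_quadratic n (a b c x : R) :
  (bernstein n (fun k => a + b * (k%:R - c) ^+ 2)).[x] =
  a + b * (n%:R * x * (1 - x) + (n%:R * x - c) ^+ 2).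
Proof.
elim: n c => [|n IH] c; first by rewrite /= hornerC; ring.
rewrite bernsteinS IH.
have -> : (fun k : nat => a + b * (k%:R - c) ^+ 2) \o S =
          (fun k : nat => a + b * (k%:R - (c - 1)) ^+ 2).
  by apply/funext => k /=; rewrite -natr1; congr (_ + _ * _ ^+ 2); ring.
by rewrite IH -natr1; ring.
Qed.

Lemma within_continuous_distP (A : set R) f : {within A, continuous f} <->
  forall x (e : R), A x -> 0 < e -> exists2 d, 0 < d &
    forall y, A y -> `|x - y| < d -> `|f x - f y| <= e.
Proof.
split=> [/subspace_continuousP cf x e Ax e0|h].
  have /cvgrPdist_le/(_ e e0) := cf x Ax.
  rewrite near_withinE => /nbhs_ballP[d /= d0 hd].
  by exists d => // y Ay xy; apply: hd.
apply/subspace_continuousP => x Ax; apply/cvgrPdist_le => e e0.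
rewrite near_withinE; have [d d0 hd] := h x e Ax e0.
by apply/nbhs_ballP; exists d => //= y xy Ay; apply: hd.
Qed.

(** Heine-Cantor theorem, by near covering of the compact interval. *)
Lemma uniform_continuous_segment f (e : R) : {within `[0, 1], continuous f} ->
  0 < e -> exists2 d, 0 < d & forall x y, 0 <= x <= 1 -> 0 <= y <= 1 ->
    `|x - y| < d -> `|f x - f y| <= e.
Proof.
move=> cf e0; pose P (d x : R) := 0 <= x <= 1 -> forall y, 0 <= y <= 1 ->
  `|x - y| < d -> `|f x - f y| <= e.
have /compact_near_coveringP := @segment_compact R 0 1.
move=> /(_ _ (0^'+)%classic P _) [].
  move=> x; rewrite /= in_itv /= => x01.
  have xI : `[0, 1]%classic x by rewrite /= in_itv.
  have e20 : 0 < e / 2 by rewrite divr_gt0.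
  have [d d0 hd] := (within_continuous_distP _ _).1 cf x _ xI e20.
  have d20 : 0 < d / 2 by rewrite divr_gt0.
  exists (ball x (d / 2), [set d' | d' < d / 2]).
    split; first exact: nbhsx_ballx.
    exact: nbhs_right_lt.
  move=> [y d'] /= [xy d'd] y01 z z01 yz.
  have xy' : `|x - y| < d / 2 by exact: xy.
  have h1 : `|f x - f y| <= e / 2.
    by apply: hd; [rewrite /= in_itv|lra].
  have h2 : `|f x - f z| <= e / 2.
    apply: hd; [by rewrite /= in_itv|].
    by have := ler_distD y x z; lra.
  by have := ler_distD (f x) (f y) (f z); rewrite [`|f y - f x|]distrC; lra.
move=> r /= r0 hr; exists (r / 2); first by rewrite divr_gt0.
move=> x y x01 y01 xy; apply: (hr (r / 2)) => //=.
- by rewrite sub0r normrN gtr0_norm ?divr_gt0//; lra.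
- by rewrite divr_gt0.
Qed.

(** Bernstein's proof: f(k/n) is compared with f(x) by uniform continuity when
    k/n is close to x, and by the second moment otherwise. *)
Lemma weierstrass01 f (e : R) : {within `[0, 1], continuous f} -> 0 < e ->
  exists p : {poly R}, forall x, 0 <= x <= 1 -> `|p.[x] - f x| <= e.
Proof.
move=> cf e0; have e20 : 0 < e / 2 by rewrite divr_gt0.
have [d d0 hd] := uniform_continuous_segment cf e20.
have [c1 _ hc1] := EVT_max ler01 cf.
have [c2 _ hc2] := EVT_min ler01 cf.
pose K := `|f c1| + `|f c2|.
have K0 : 0 <= K by rewrite addr_ge0.
have hK x : 0 <= x <= 1 -> `|f x| <= K.
  move=> x01; have xI : x \in `[0, 1] by rewrite in_itv.
  have := hc1 x xI; have := hc2 x xI; rewrite /K ler_norml.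
  have := ler_norm (f c1); have := ler_norm (- f c2); rewrite normrN.
  by have := normr_ge0 (f c1); have := normr_ge0 (f c2); lra.
have [N _ hN] : \forall n \near \oo, n.+1%:R^-1 < e / 2 / (2 * K / d ^+ 2 + 1).
  have h : 0 < e / 2 / (2 * K / d ^+ 2 + 1).
    by rewrite divr_gt0// ltr_wpDl// divr_ge0 ?sqr_ge0 ?mulr_ge0.
  exact: (near_infty_natSinv_lt (PosNum h)).
pose n := N.+1; have n0 : (0 : R) < n%:R by rewrite ltr0n.
have hn : 2 * K / d ^+ 2 / n%:R <= e / 2.
  have /= := hN N (leqnn N).
  rewrite ltr_pdivlMr ?ltr_wpDl ?divr_ge0 ?sqr_ge0 ?mulr_ge0// => h.
  apply: le_trans (ltW h); rewrite [X in _ <= X]mulrC ler_wpM2r ?invr_ge0//.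
  by rewrite lerDl.
exists (bernstein n (fun k => f (k%:R / n%:R))) => x x01.
have kn k : (k <= n)%N -> 0 <= (k%:R / n%:R : R) <= 1.
  by move=> kn; rewrite divr_ge0//= ler_pdivrMr// mul1r ler_nat.
(* Close to x the increment of f is at most e / 2; elsewhere it is at most 2 K,
   while the quadratic term is then at least 2 K. *)
have loc k : (k <= n)%N -> `|f (k%:R / n%:R) - f x| <=
    e / 2 + 2 * K / d ^+ 2 / n%:R ^+ 2 * (k%:R - n%:R * x) ^+ 2.
  move=> /kn hk; set y := k%:R / n%:R in hk *.
  have -> : k%:R - n%:R * x = n%:R * (y - x) by rewrite /y; field; lra.
  have -> : 2 * K / d ^+ 2 / n%:R ^+ 2 * (n%:R * (y - x)) ^+ 2 =
            2 * K * ((y - x) ^+ 2 / d ^+ 2) by field; rewrite !gt_eqF.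
  have [xy|xy] := ltP `|y - x| d.
    apply: le_trans (hd _ _ hk x01 xy) _.
    by rewrite lerDl mulr_ge0// ?divr_ge0 ?sqr_ge0 ?mulr_ge0.
  apply: le_trans (ler_normB _ _) _; apply: le_trans (_ : 2 * K <= _).
    by have := hK _ hk; have := hK _ x01; lra.
  apply: le_trans (_ : 2 * K * ((y - x) ^+ 2 / d ^+ 2) <= _); last by rewrite lerDr ltW.
  rewrite -[X in X <= _]mulr1 ler_wpM2l ?mulr_ge0// ler_pdivlMr ?exprn_gt0// mul1r.
  by rewrite -[(y - x) ^+ 2]real_normK ?num_real// ler_pXn2r ?nnegrE ?(ltW d0).
set b := 2 * K / d ^+ 2 / n%:R ^+ 2 in loc.
have b0 : 0 <= b by rewrite !divr_ge0 ?sqr_ge0 ?mulr_ge0.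
have moment : b * (n%:R * x * (1 - x) + (n%:R * x - n%:R * x) ^+ 2) <= e / 2.
  apply: le_trans hn.
  have -> : b * (n%:R * x * (1 - x) + (n%:R * x - n%:R * x) ^+ 2) =
     2 * K / d ^+ 2 / n%:R * (x * (1 - x)) by rewrite /b; field; rewrite !gt_eqF.
  rewrite -[X in _ <= X]mulr1 ler_wpM2l ?divr_ge0 ?sqr_ge0 ?mulr_ge0//.
  by nra.
rewrite ler_norml; apply/andP; split.
- have : (bernstein n (fun k => (f x - e / 2) + - b * (k%:R - n%:R * x) ^+ 2)).[x]
      <= (bernstein n (fun k => f (k%:R / n%:R))).[x].
    apply: ler_bernstein => // k /loc; rewrite ler_norml => /andP[+ _].
    by rewrite mulNr; move: (b * _) => B; lra.
  by rewrite bernstein_quadratic mulNr; lra.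
- have : (bernstein n (fun k => f (k%:R / n%:R))).[x] <=
    (bernstein n (fun k => (f x + e / 2) + b * (k%:R - n%:R * x) ^+ 2)).[x].
    apply: ler_bernstein => // k /loc; rewrite ler_norml => /andP[_ +].
    by move: (b * _) => B; lra.
  by rewrite bernstein_quadratic; lra.
Qed.

Lemma weierstrass f (M e : R) : 0 < M -> {within `[0, M], continuous f} -> 0 < e ->
  exists p : {poly R}, forall x, 0 <= x <= M -> `|p.[x] - f x| <= e.
Proof.
move=> M0 cf e0.
have [|p hp] := @weierstrass01 (f \o *%R M) e _ e0.
  apply/within_continuous_distP => x d; rewrite /= in_itv /= => /andP[x0 x1] d0.
  have xI : `[0, M]%classic (M * x).
    by rewrite /= in_itv /= mulr_ge0 ?(ltW M0)//= -[X in _ <= X]mulr1 ler_pM2l.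
  have [d' d'0 hd] := (within_continuous_distP _ _).1 cf _ _ xI d0.
  exists (d' / M); first by rewrite divr_gt0.
  move=> y; rewrite in_itv /= => /andP[y0 y1]; rewrite ltr_pdivlMr// => xy.
  apply: hd; last by rewrite -mulrBr normrM gtr0_norm// mulrC.
  by rewrite /= in_itv /= mulr_ge0 ?(ltW M0)//= -[X in _ <= X]mulr1 ler_pM2l.
exists (p \Po (M^-1 *: 'X)) => x /andP[x0 xM].
have := hp (M^-1 * x); rewrite horner_comp !hornerE /= mulVKf ?gt_eqF//; apply.
by rewrite mulr_ge0 ?invr_ge0 ?(ltW M0)//= ler_pdivrMl// mulr1.
Qed.

End Bernstein.

(** * The continuous functional calculus of a positive operator *)

Section FunctionalCalculus.
Context {R : realType} {Omega : Type} {H : rkhs R Omega}.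
Implicit Types (T S P B Q : H -> H) (u v w : H) (p q : {poly R}) (f g : R -> R).
Local Notation "<< u , v >>" := (rkhs_inner H u v).
Local Notation Re := complex.Re.

Lemma opnorm_le T e : 0 <= e -> opbound T e -> 0 <= opnorm T <= e.
Proof.
move=> e0 hT; have T0 : T 0 = 0.
  by apply/eqP; rewrite -vnorm_eq0 eq_le vnorm_ge0 (le_trans (hT 0))// vnorm0 mulr0.
have ub : ubound [set Re `|T u| | u in [set u : H | `|u| <= 1]] e.
  move=> _ [u /= u1 <-]; rewrite -/(vnorm (T u)).
  have h : vnorm u <= 1 by rewrite -lecR -vnormE.
  by apply: le_trans (hT u) _; rewrite -[X in _ <= X]mulr1 ler_wpM2l.
have z : [set Re `|T u| | u in [set u : H | `|u| <= 1]] 0.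
  by exists 0; rewrite /= ?normr0// T0 normr0.
apply/andP; split; first by apply: ub_le_sup => //; exists e.
by apply: ge_sup => //; exists 0.
Qed.

Lemma opbound_opnorm T : bounded_operator T -> opbound T (opnorm T).
Proof.
move=> bT u; have [lT [K K0 hK]] := (bounded_operatorP _).1 bT.
have [->|u0] := eqVneq u 0; first by rewrite (linearf0 lT) vnorm0 mulr0.
have n0 : 0 < vnorm u by rewrite vnorm_gt0.
pose v : H := (vnorm u)^-1%:C *: u.
have uv : u = (vnorm u)%:C *: v.
  by rewrite /v scalerA -rmorphM mulfV ?scale1r// gt_eqF.
have v1 : vnorm v = 1.
  by rewrite /v vnormZ cabsR gtr0_norm ?invr_gt0// mulVf ?gt_eqF.
rewrite {1}uv (linearfZ lT) vnormZ cabsR gtr0_norm// mulrC ler_wpM2r ?vnorm_ge0//.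
apply: ub_le_sup; last by exists v => //=; rewrite vnormE v1.
exists K => _ [w /= w1 <-]; rewrite -/(vnorm (T w)).
have h : vnorm w <= 1 by rewrite -lecR -vnormE.
by apply: le_trans (hK w) _; rewrite -[X in _ <= X]mulr1 ler_wpM2l.
Qed.

Lemma is_cfc_approx g P T : bounded_operator P -> is_cfc g P T ->
  forall e : R, 0 < e -> exists2 p,
    forall r, spectrum P r%:C -> `|p.[r] - g r| <= e &
    opbound (poly_op p P \- T) e.
Proof.
move=> bP [bT [p [up op]]] e e0.
have [|N _ hN] := up [set f | forall y, spectrum P y%:C -> `|g y - f y| < e].
  apply/uniform_nbhs; exists [set xy | ball xy.1 e xy.2]; split.
    exact: (entourage_ball _ (PosNum e0)).
  by move=> f h y /h.
have /cvgrPdist_le/(_ e e0) [M _ hM] := op.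
exists (p (maxn N M)).
  by move=> r rs; rewrite distrC ltW//; apply: (hN _ (leq_maxl N M)).
move=> u; have := hM _ (leq_maxr N M); rewrite /= sub0r normrN => h.
apply: le_trans (opbound_opnorm (bounded_sub (bounded_poly_op _ bP) bT) u) _.
by rewrite ler_wpM2r ?vnorm_ge0// (le_trans (ler_norm _)).
Qed.

Lemma ler_of_le_scaled (x C : R) :
  (forall e, 0 < e -> e <= 1 -> x <= C * e) -> x <= 0.
Proof.
move=> h; apply/ler_addgt0Pl => e e0; rewrite addr0.
have d0 : 0 < `|C| + 1 by rewrite ltr_wpDl.
pose d := Num.min 1 (e / (`|C| + 1)).
have dp : 0 < d by rewrite lt_min ltr01 divr_gt0.
have d1 : d <= 1 by rewrite ge_min lexx.
have d2 : d <= e / (`|C| + 1) by rewrite ge_min lexx orbT.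
apply: le_trans (h d dp d1) _.
apply: le_trans (_ : (`|C| + 1) * d <= _).
  by rewrite ler_wpM2r ?(ltW dp)//; have := ler_norm C; lra.
by rewrite mulrC -ler_pdivlMr.
Qed.

(** If p is within e of g on the spectrum of P, then p(P) is within e of every T
    such that [is_cfc g P T]: the polynomials witnessing [is_cfc] do not
    matter. *)
Lemma is_cfc_opbound g P T p e : bounded_operator P -> symm P -> is_cfc g P T ->
  0 <= e -> (forall r, spectrum P r%:C -> `|p.[r] - g r| <= e) ->
  opbound (poly_op p P \- T) e.
Proof.
move=> bP sP hT e0 hp u; rewrite -subr_le0.
apply: (@ler_of_le_scaled _ (2 * vnorm u)) => d d0 _.
have [q hq Tq] := is_cfc_approx bP hT d0.
have hpq : opbound (poly_op (p - q) P) (e + d).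
  apply: opbound_poly_op => //; first by rewrite addr_ge0// ltW.
  move=> r rs; have := ler_distD (g r) p.[r] q.[r]; rewrite !hornerE.
  by have := hp _ rs; have := hq _ rs; rewrite [`|g r - _|]distrC; lra.
have -> : (poly_op p P \- T) u = poly_op (p - q) P u + (poly_op q P \- T) u.
  by rewrite poly_opB /= addrA subrK.
have := ler_vnormD (poly_op (p - q) P u) ((poly_op q P \- T) u).
by have := hpq u; have := Tq u; rewrite mulrDl; lra.
Qed.

(** Bounded positive operators. *)
Definition positive_op P := [/\ bounded_operator P, symm P & psd P].

Lemma positive_spectrum P K r : positive_op P -> opbound P K ->
  spectrum P r%:C -> 0 <= r <= K.
Proof.
move=> [bP sP pP] hK rs; apply/andP; split.
  by apply: (spectrum_ge bP sP _ rs) => u; rewrite mul0r.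
apply: (spectrum_le bP sP _ rs) => u.
exact: le_trans (ler_norm _) (opbound_qf u hK).
Qed.

(* Continuity on [0, +oo[, which contains the spectrum of a positive operator. *)
Local Notation cont0y g := ({within `[0, +oo[, continuous g}).

(** Polynomials converging to g uniformly on an interval that contains the
    spectrum of P have a norm limit at P. *)
Lemma is_cfc_exists g P : positive_op P -> cont0y g -> exists T, is_cfc g P T.
Proof.
move=> oP cg; have [bP sP pP] := oP.
have [lP [K K0 hK]] := (bounded_operatorP _).1 bP.
have K1 : 0 < K + 1 by rewrite ltr_wpDl.
have cgK : {within `[0, K + 1], continuous g}.
  apply: continuous_subspaceW cg => x /=; rewrite !in_itv /= => /andP[-> //].
have hp n : {p : {poly R} | forall x, 0 <= x <= K + 1 -> `|p.[x] - g x| <= n.+1%:R^-1}.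
  by apply: cid; apply: weierstrass => //; rewrite invr_gt0.
pose p n := sval (hp n).
have pg n r : spectrum P r%:C -> `|(p n).[r] - g r| <= n.+1%:R^-1.
  move=> /(positive_spectrum oP hK) /andP[r0 rK].
  by apply: (svalP (hp n)); rewrite r0 /=; lra.
have pd n m : opbound (poly_op (p n - p m) P) (n.+1%:R^-1 + m.+1%:R^-1).
  apply: opbound_poly_op => //.
  move=> r rs; have := ler_distD (g r) (p n).[r] (p m).[r]; rewrite !hornerE.
  have := pg n _ rs; have := pg m _ rs; rewrite [`|g r - _|]distrC.
  by move: (n.+1%:R^-1) (m.+1%:R^-1) => ? ?; lra.
have smallN (e : R) : 0 < e -> exists N, forall n, (N <= n)%N -> n.+1%:R^-1 <= e.
  move=> e0; have [N _ hN] := near_infty_natSinv_lt (PosNum e0).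
  by exists N => n Nn; apply: ltW; exact: hN.
have hT u : {w | forall e, 0 < e -> exists N, forall n, (N <= n)%N ->
    vnorm (poly_op (p n) P u - w) <= e}.
  apply/cid/hilbert_complete => e e0.
  have d0 : 0 < e / 2 / (vnorm u + 1) by rewrite !divr_gt0// ltr_wpDl ?vnorm_ge0.
  have [N hN] := smallN _ d0; exists N => i j /hN + /hN.
  rewrite -poly_opB !ler_pdivlMr ?ltr_wpDl ?vnorm_ge0// => hi hj.
  apply: le_trans (pd i j u) _; move: hi hj.
  have i0 : 0 <= (i.+1%:R^-1 : R) by rewrite invr_ge0.
  have j0 : 0 <= (j.+1%:R^-1 : R) by rewrite invr_ge0.
  by move: i0 j0; move: (i.+1%:R^-1) (j.+1%:R^-1) => x y *; lra.
pose T u := sval (hT u).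
have TP n : opbound (poly_op (p n) P \- T) n.+1%:R^-1.
  move=> u; apply/ler_addgt0Pl => e e0 /=.
  have e20 : 0 < e / 2 by rewrite divr_gt0.
  have [N hN] := svalP (hT u) _ e20; rewrite -/(T u) in hN.
  have d0 : 0 < e / 2 / (vnorm u + 1) by rewrite !divr_gt0// ltr_wpDl ?vnorm_ge0.
  have [M hM] := smallN _ d0.
  pose m := maxn N M; have h1 := hN m (leq_maxl _ _).
  have := hM m (leq_maxr _ _); rewrite ler_pdivlMr ?ltr_wpDl ?vnorm_ge0//.
  have := pd n m u; rewrite poly_opB => h2 h3.
  have -> : poly_op (p n) P u - T u = (poly_op (p n) P u - poly_op (p m) P u) +
     (poly_op (p m) P u - T u) by rewrite addrA subrK.
  apply: le_trans (ler_vnormD _ _) _.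
  have m0 : 0 <= (m.+1%:R^-1 : R) by rewrite invr_ge0.
  move: h2 h3 m0; rewrite mulrDl; move: (n.+1%:R^-1) (m.+1%:R^-1) => x y *.
  by lra.
have lT : linear T.
  move=> a u v; apply/eqP; rewrite -subr_eq0 -vnorm_eq0 eq_le vnorm_ge0 andbT.
  set w := a *: u + v.
  apply: (@ler_of_le_scaled _ (vnorm w + cabs a * vnorm u + vnorm v)) => e e0 _.
  have [N /(_ N (leqnn _)) hN] := smallN e e0.
  have lp := bounded_linear (bounded_poly_op (p N) bP).
  have -> : T w - (a *: T u + T v) =
     - ((poly_op (p N) P \- T) w) + a *: ((poly_op (p N) P \- T) u) +
     (poly_op (p N) P \- T) v.
    rewrite /= {1}/w lp scalerBr.
    move: (T w) (a *: T u) (T v) (a *: poly_op _ _ u) (poly_op _ _ v) => z x' y' x y.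
    by rewrite opprB !opprD !addrA [_ + x]addrAC subrK [_ + y]addrAC subrK.
  have h := TP N.
  apply: le_trans (ler_vnormD _ _) _; rewrite !mulrDl lerD//; last first.
    by apply: le_trans (h v) _; rewrite mulrC ler_wpM2l ?vnorm_ge0.
  apply: le_trans (ler_vnormD _ _) _; rewrite vnormN vnormZ lerD//.
    by apply: le_trans (h w) _; rewrite mulrC ler_wpM2l ?vnorm_ge0.
  rewrite -mulrA ler_wpM2l ?cabs_ge0//.
  by apply: le_trans (h u) _; rewrite mulrC ler_wpM2l ?vnorm_ge0.
have bT : bounded_operator T.
  apply/bounded_operatorP; split=> //.
  have [lp [L L0 hL]] := (bounded_operatorP _).1 (bounded_poly_op (p 0%N) bP).
  exists (1 + L); first by rewrite addr_ge0.
  move=> u; have -> : T u = - ((poly_op (p 0%N) P \- T) u) + poly_op (p 0%N) P u.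
    by rewrite /= opprB subrK.
  apply: le_trans (ler_vnormD _ _) _; rewrite vnormN mulrDl lerD//.
  by have := TP 0%N u; rewrite invr1.
exists T; split=> //; exists p; split.
  move=> A /uniform_nbhs [E [+ hA]].
  rewrite -entourage_from_ballE => -[e /= e0 he].
  have [N _ hN] := near_infty_natSinv_lt (PosNum e0).
  exists N => // n /= Nn; apply: hA => y ys; apply: he => /=.
  rewrite -ball_normE /= distrC; apply: le_lt_trans (pg n y ys) _.
  exact: hN.
apply/cvgrPdist_le => e e0; have [N hN] := smallN e e0.
exists N => // n /= Nn; rewrite sub0r normrN.
have /andP[h1 h2] : 0 <= opnorm (poly_op (p n) P \- T) <= n.+1%:R^-1.
  by apply: opnorm_le.
by rewrite ger0_norm// (le_trans h2)// hN.
Qed.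

Lemma cfcP g P : positive_op P -> cont0y g -> is_cfc g P (cfc g P).
Proof.
move=> oP cg; have [T hT] := is_cfc_exists oP cg.
exact: (@xgetPex _ (fun=> 0) [set T | is_cfc g P T] (ex_intro _ T hT)).
Qed.

Lemma cfc_bounded g P : positive_op P -> cont0y g -> bounded_operator (cfc g P).
Proof. by move=> oP cg; case: (cfcP oP cg). Qed.

Lemma cfc_opbound g P K p e : positive_op P -> opbound P K -> cont0y g -> 0 <= e ->
  (forall r, 0 <= r <= K -> `|p.[r] - g r| <= e) -> opbound (poly_op p P \- cfc g P) e.
Proof.
move=> oP hK cg e0 hp; have [bP sP _] := oP.
apply: (is_cfc_opbound bP sP (cfcP oP cg)) => // r rs.
by apply: hp; exact: positive_spectrum oP hK rs.
Qed.

Lemma weierstrass0y g (K e : R) : cont0y g -> 0 < e ->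
  exists p, forall r, 0 <= r <= K -> `|p.[r] - g r| <= e.
Proof.
move=> cg e0; have [|||p hp] := @weierstrass _ g (`|K| + 1) e.
- by rewrite ltr_wpDl.
- apply: continuous_subspaceW cg => x /=; rewrite !in_itv /= => /andP[-> //].
- exact: e0.
- exists p => r /andP[r0 rK]; apply: hp; rewrite r0 /=.
  by have := ler_norm K; lra.
Qed.

Lemma cfc_approx f P K e : positive_op P -> opbound P K -> cont0y f -> 0 < e ->
  exists2 p, (forall r, 0 <= r <= K -> `|p.[r] - f r| <= e) &
    opbound (poly_op p P \- cfc f P) e.
Proof.
move=> oP hK cf e0; have [p hp] := weierstrass0y K cf e0; exists p => //.
by apply: cfc_opbound hp => //; exact: ltW.
Qed.

Lemma opbound_le T K K' : opbound T K -> K <= K' -> opbound T K'.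
Proof.
by move=> h KK u; apply: le_trans (h u) _; rewrite ler_wpM2r ?vnorm_ge0.
Qed.

(** An operator approximated by polynomials in P close to g is g(P). *)
Lemma cfc_unique g P K C T : positive_op P -> opbound P K -> cont0y g -> 0 <= C ->
  (forall e, 0 < e -> e <= 1 -> exists2 p,
    (forall r, 0 <= r <= K -> `|p.[r] - g r| <= C * e) &
     opbound (poly_op p P \- T) (C * e)) -> cfc g P = T.
Proof.
move=> oP hK cg C0 h; apply/funext => u.
apply/eqP; rewrite -subr_eq0 -vnorm_eq0 eq_le vnorm_ge0 andbT.
apply: (@ler_of_le_scaled _ (2 * C * vnorm u)) => e e0 e1.
have [p hp /(_ u) Tp] := h e e0 e1.
have Ce0 : 0 <= C * e by rewrite mulr_ge0// ltW.
have /(_ u) := cfc_opbound oP hK cg Ce0 hp.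
have -> : cfc g P u - T u = (poly_op p P \- T) u + - (poly_op p P \- cfc g P) u.
  by rewrite /= opprB [RHS]addrC addrA subrK.
move=> h2; apply: le_trans (ler_vnormD _ _) _; rewrite vnormN.
by apply: le_trans (lerD Tp h2) _; rewrite -mulrDl -mulr2n -mulr_natl; lra.
Qed.

Lemma cfc_eq f g P : positive_op P -> cont0y f -> cont0y g ->
  (forall x, 0 <= x -> f x = g x) -> cfc f P = cfc g P.
Proof.
move=> oP cf cg fg; have [bP _ _] := oP.
have [lP [K K0 hK]] := (bounded_operatorP _).1 bP.
apply: (cfc_unique (C := 1) oP hK cf) => // e e0 e1; rewrite mul1r.
have [p hp hT] := cfc_approx oP hK cg e0; exists p => // r /[dup] rK /hp.
by case/andP: rK => r0 _; rewrite fg.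
Qed.

Lemma cfc_horner p P : positive_op P -> cont0y (horner p) ->
  cfc (horner p) P = poly_op p P.
Proof.
move=> oP cp; have [bP _ _] := oP.
have [lP [K K0 hK]] := (bounded_operatorP _).1 bP.
apply: (cfc_unique (C := 0) oP hK cp) => // e e0 e1; rewrite mul0r.
by exists p => [r _|u]; rewrite /= subrr ?normr0// vnorm0 mul0r.
Qed.

Lemma cont0y_horner p : cont0y (horner p).
Proof.
apply: continuous_subspaceT; elim/poly_ind: p => [|p c IH] x.
  rewrite (_ : horner 0 = fun=> 0); first exact: cvg_cst.
  by apply/funext => y; rewrite horner0.
rewrite (_ : horner _ = (horner p \* id) \+ fun=> c).
  apply: continuousD; last exact: cvg_cst.
  by apply: continuousM => //; exact: IH.
by apply/funext => y; rewrite /= hornerMXaddC.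
Qed.

Lemma cfc_add f g P : positive_op P -> cont0y f -> cont0y g ->
  cont0y (f \+ g) -> cfc (f \+ g) P = cfc f P \+ cfc g P.
Proof.
move=> oP cf cg cfg; have [bP _ _] := oP.
have [lP [K K0 hK]] := (bounded_operatorP _).1 bP.
apply: (cfc_unique (C := 2) oP hK cfg) => // e e0 e1.
have [p hp hT] := cfc_approx oP hK cf e0.
have [q hq hS] := cfc_approx oP hK cg e0.
exists (p + q) => [r rK|u].
  have := hp r rK; have := hq r rK; rewrite hornerD /= => h1 h2.
  have -> : p.[r] + q.[r] - (f r + g r) = (p.[r] - f r) + (q.[r] - g r) by ring.
  by apply: le_trans (ler_normD _ _) _; lra.
have -> : (poly_op (p + q) P \- (cfc f P \+ cfc g P)) u =
  (poly_op p P \- cfc f P) u + (poly_op q P \- cfc g P) u.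
  by rewrite /= poly_opD opprD addrACA.
apply: le_trans (ler_vnormD _ _) _; have := hT u; have := hS u => h1 h2.
by apply: le_trans (lerD h2 h1) _; lra.
Qed.

Lemma cont0y_bounded g K : cont0y g ->
  exists2 B, 0 <= B & forall r, 0 <= r <= K -> `|g r| <= B.
Proof.
move=> cg; have cgK : {within `[0, `|K|], continuous g}.
  by apply: continuous_subspaceW cg => x /=; rewrite !in_itv /= => /andP[-> //].
have [c1 _ hc1] := EVT_max (normr_ge0 K) cgK.
have [c2 _ hc2] := EVT_min (normr_ge0 K) cgK.
exists (`|g c1| + `|g c2|) => // r /andP[r0 rK].
have rI : r \in `[0, `|K|] by rewrite in_itv /= r0 (le_trans rK)// ler_norm.
have := hc1 r rI; have := hc2 r rI; rewrite ler_norml.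
have := ler_norm (g c1); have := ler_norm (- g c2); rewrite normrN.
by have := normr_ge0 (g c1); have := normr_ge0 (g c2); lra.
Qed.

Lemma cfc_mul f g P : positive_op P -> cont0y f -> cont0y g ->
  cont0y (f \* g) -> cfc (f \* g) P = cfc f P \o cfc g P.
Proof.
move=> oP cf cg cfg; have [bP _ _] := oP.
have [lP [K K0 hK]] := (bounded_operatorP _).1 bP.
have [Bf Bf0 hf] := cont0y_bounded K cf.
have [Bg Bg0 hg] := cont0y_bounded K cg.
have [lF [KF KF0 hF]] := (bounded_operatorP _).1 (cfc_bounded oP cf).
have [lG [KG KG0 hG]] := (bounded_operatorP _).1 (cfc_bounded oP cg).
apply: (cfc_unique (C := (Bg + 1 + Bf) + (1 + KG + KF)) oP hK cfg).
  by rewrite !addr_ge0.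
move=> e e0 e1.
have [p hp hT] := cfc_approx oP hK cf e0.
have [q hq hS] := cfc_approx oP hK cg e0.
exists (p * q) => [r rK|u].
  have hp' := hp r rK; have hq' := hq r rK; rewrite hornerM /=.
  have hf' := hf r rK; have hg' := hg r rK.
  have -> : p.[r] * q.[r] - f r * g r =
    (p.[r] - f r) * (g r + (q.[r] - g r)) + f r * (q.[r] - g r) by ring.
  apply: le_trans (ler_normD _ _) _; rewrite !normrM.
  apply: le_trans (_ : (Bg + 1 + Bf) * e <= _); last first.
    by rewrite ler_wpM2r ?(ltW e0)// lerDl !addr_ge0.
  rewrite mulrDl; apply: lerD; last by rewrite ler_pM.
  rewrite [(Bg + 1) * e]mulrC ler_pM//.
  by apply: le_trans (ler_normD _ _) _; lra.
have -> : (poly_op (p * q) P \- (cfc f P \o cfc g P)) u =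
  (poly_op p P \- cfc f P) (poly_op q P u) +
   cfc f P ((poly_op q P \- cfc g P) u).
  by rewrite /= poly_opM// (linearfB lF) addrA subrK.
apply: le_trans (ler_vnormD _ _) _.
have h1 := hT (poly_op q P u).
have h2 : vnorm (poly_op q P u) <= (1 + KG) * vnorm u.
  have -> : poly_op q P u = (poly_op q P \- cfc g P) u + cfc g P u.
    by rewrite /= subrK.
  apply: le_trans (ler_vnormD _ _) _; rewrite mulrDl lerD//.
  by apply: opbound_le hS e1 u.
have h3 := hF ((poly_op q P \- cfc g P) u).
have h4 := hS u.
apply: le_trans (_ : e * ((1 + KG) * vnorm u) + KF * (e * vnorm u) <= _).
  rewrite lerD//; first by apply: le_trans h1 _; rewrite ler_wpM2l// ltW.
  by apply: le_trans h3 _; rewrite ler_wpM2l.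
have -> : e * ((1 + KG) * vnorm u) + KF * (e * vnorm u) = (1 + KG + KF) * e * vnorm u.
  by ring.
by rewrite ler_wpM2r ?vnorm_ge0// ler_wpM2r ?(ltW e0)// lerDr !addr_ge0.
Qed.

Lemma cfc_symm g P : positive_op P -> cont0y g -> symm (cfc g P).
Proof.
move=> oP cg u v; have [bP sP _] := oP.
have [lP [K K0 hK]] := (bounded_operatorP _).1 bP.
apply/eqP; rewrite -subr_eq0 -cabs_eq0 eq_le cabs_ge0 andbT.
apply: (@ler_of_le_scaled _ (2 * (vnorm u * vnorm v))) => e e0 e1.
have [p hp hT] := cfc_approx oP hK cg e0.
have -> : <<cfc g P u, v>> - <<u, cfc g P v>> =
   <<u, (poly_op p P \- cfc g P) v>> + <<- (poly_op p P \- cfc g P) u, v>>.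
  rewrite /= dotBr opprB dotBl (symm_poly_op p sP u v).
  by rewrite [RHS]addrC addrA subrK.
apply: le_trans (ler_cabsD _ _) _.
apply: le_trans (lerD (cauchy_schwarz _ _) (cauchy_schwarz _ _)) _.
rewrite vnormN; have h1 := hT u; have h2 := hT v.
apply: le_trans (_ : vnorm u * (e * vnorm v) + e * vnorm u * vnorm v <= _).
  by rewrite lerD ?ler_wpM2l ?ler_wpM2r ?vnorm_ge0.
by rewrite le_eqVlt; apply/orP; left; apply/eqP; ring.
Qed.

Lemma qf_sub S T u : qf (S \- T) u = qf S u - qf T u.
Proof.
by rewrite /qf /= dotBl; case: (<<S u, u>>) (<<T u, u>>) => a b [].
Qed.

Lemma cfc_le f g P u : positive_op P -> cont0y f -> cont0y g ->
  (forall x, 0 <= x -> f x <= g x) -> qf (cfc f P) u <= qf (cfc g P) u.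
Proof.
move=> oP cf cg fg; have [bP sP _] := oP.
have [lP [K K0 hK]] := (bounded_operatorP _).1 bP.
rewrite -subr_le0; apply: (@ler_of_le_scaled _ (4 * vnorm u ^+ 2)) => e e0 e1.
have [p hp hT] := cfc_approx oP hK cf e0.
have [q hq hS] := cfc_approx oP hK cg e0.
have : 0 <= qf (poly_op (q + (2 * e)%:P - p) P) u.
  apply: psd_poly_op => // r /(positive_spectrum oP hK) /[dup] rK /andP[r0 _].
  have := fg _ r0; have := hp _ rK; have := hq _ rK; rewrite !hornerE.
  by rewrite !ler_norml; lra.
have -> : qf (poly_op (q + (2 * e)%:P - p) P) u =
    qf (poly_op q P) u + 2 * e * vnorm u ^+ 2 - qf (poly_op p P) u.
  rewrite /qf poly_opB poly_opD poly_opC dotBl dotDl dotZl dotE.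
  case: (<<poly_op q P u, u>>) (<<poly_op p P u, u>>) => a b [c d] /=; ring.
have := opbound_qf u hT; have := opbound_qf u hS; rewrite !qf_sub !ler_norml.
by lra.
Qed.

Lemma cfc_psd g P : positive_op P -> cont0y g -> (forall x, 0 <= x -> 0 <= g x) ->
  positive_op (cfc g P).
Proof.
move=> oP cg g0; split; [exact: cfc_bounded|exact: cfc_symm|] => u.
have c0 := @cont0y_horner 0.
apply: le_trans (cfc_le u oP c0 cg _) => [|x x0]; last by rewrite horner0 g0.
by rewrite cfc_horner// /qf poly_opC scale0r dot0l.
Qed.

Lemma cfc_intertwine g P Q B : positive_op P -> positive_op Q -> cont0y g ->
  bounded_operator B -> (forall v, B (P v) = Q (B v)) ->
  forall u, B (cfc g P u) = cfc g Q (B u).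
Proof.
move=> oP oQ cg bB h u; have [bP _ _] := oP; have [bQ _ _] := oQ.
have [lB [L L0 hL]] := (bounded_operatorP _).1 bB.
have [lP [K K0 hK]] := (bounded_operatorP _).1 bP.
have [lQ [K' K'0 hK']] := (bounded_operatorP _).1 bQ.
have hP : opbound P (K + K') by apply: opbound_le hK _; rewrite lerDl.
have hQ : opbound Q (K + K') by apply: opbound_le hK' _; rewrite lerDr.
apply/eqP; rewrite -subr_eq0 -vnorm_eq0 eq_le vnorm_ge0 andbT.
apply: (@ler_of_le_scaled _ (L * vnorm u + vnorm (B u))) => e e0 e1.
have [p hp hT] := cfc_approx oP hP cg e0.
have /(_ (B u)) hS := cfc_opbound oQ hQ cg (ltW e0) hp.
have -> : B (cfc g P u) - cfc g Q (B u) =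
   - B ((poly_op p P \- cfc g P) u) + (poly_op p Q \- cfc g Q) (B u).
  rewrite /= (linearfB lB) (poly_op_intertwine p lB h) opprB.
  by rewrite addrA subrK.
apply: le_trans (ler_vnormD _ _) _; rewrite vnormN mulrDl lerD//; last first.
  by rewrite mulrC.
apply: le_trans (hL _) _; rewrite -mulrA ler_wpM2l//.
by rewrite mulrC; exact: hT.
Qed.

End FunctionalCalculus.

(** * Convexity of Orlicz functions *)

Section Orlicz.
Context {R : realType}.
Variable phi : R -> R.
Hypothesis ophi : orlicz phi.

Lemma orlicz_le x y : 0 <= x -> x <= y -> phi x <= phi y.
Proof.
move=> x0 xy; apply: (orlicz_increasing ophi) => //; rewrite !in_itv /= andbT//.
exact: le_trans xy.
Qed.

Lemma orlicz_conv t x y : 0 <= t <= 1 -> 0 <= x -> 0 <= y ->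
  phi (t * x + (1 - t) * y) <= t * phi x + (1 - t) * phi y.
Proof.
move=> /andP[t0 t1] x0 y0.
have := @orlicz_convex _ _ ophi (Itv01 t0 t1) x y; rewrite !convRE /=.
by apply; rewrite inE /= in_itv /= andbT.
Qed.

Lemma orlicz_mid x y : 0 <= x -> 0 <= y ->
  phi (2^-1 * (x + y)) <= 2^-1 * (phi x + phi y).
Proof.
move=> x0 y0; have := @orlicz_conv 2^-1 x y _ x0 y0.
rewrite (_ : 1 - 2^-1 = 2^-1 :> R) -?mulrDr; last by field.
by apply; lra.
Qed.

(** Supporting line of a convex function at an interior point; at 0 the zero
    slope does, as phi attains its minimum there. *)
Lemma orlicz_support m : 0 <= m ->
  exists c, forall s, 0 <= s -> phi m + c * (s - m) <= phi s.
Proof.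
rewrite le_eqVlt => /orP[/eqP <-|m0].
  exists 0 => s s0; rewrite mul0r addr0 (orlicz0 ophi).
  exact: (orlicz_ge0 ophi).
have slope s z : 0 <= s -> s < m -> m < z ->
    (phi m - phi s) / (m - s) <= (phi z - phi m) / (z - m).
  move=> s0 sm mz; rewrite ler_pdivrMr ?subr_gt0// mulrAC ler_pdivlMr ?subr_gt0//.
  have sz : 0 < z - s by lra.
  have t01 : 0 <= (z - m) / (z - s) <= 1.
    by rewrite divr_ge0 ?(ltW sz)//= ?ler_pdivrMr// ?mul1r; lra.
  have := orlicz_conv t01 s0 (ltW (lt_trans m0 mz)).
  have -> : (z - m) / (z - s) * s + (1 - (z - m) / (z - s)) * z = m by field; lra.
  have -> : (z - m) / (z - s) * phi s + (1 - (z - m) / (z - s)) * phi z =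
    ((z - m) * phi s + (m - s) * phi z) / (z - s) by field; lra.
  by rewrite ler_pdivlMr//; lra.
pose E := [set (phi m - phi s) / (m - s) | s in [set s | 0 <= s < m]].
have hE : has_sup E.
  split; first by exists ((phi m - phi 0) / (m - 0)), 0 => //=; rewrite lexx.
  exists ((phi (m + 1) - phi m) / (m + 1 - m)) => _ [s /andP[s0 sm] <-].
  by apply: slope => //; lra.
exists (sup E) => s s0; have [sm|ms|->] := ltgtP s m; last by rewrite subrr mulr0 addr0.
  have : (phi m - phi s) / (m - s) <= sup E.
    by apply: sup_upper_bound => //; exists s => //=; rewrite s0.
  by rewrite ler_pdivrMr ?subr_gt0//; lra.
have : sup E <= (phi s - phi m) / (s - m).
  apply: ge_sup; first by case: hE.
  by move=> _ [r /andP[r0 rm] <-]; apply: slope.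
by rewrite ler_pdivlMr ?subr_gt0//; lra.
Qed.

End Orlicz.

(** * Jensen, mixed Schwarz and Buzano inequalities *)

Section OperatorInequalities.
Context {R : realType} {Omega : Type} {H : rkhs R Omega}.
Implicit Types (T S P B Q A : H -> H) (u v w k x y : H).
Implicit Types (p q : {poly R}) (f g h : R -> R).
Local Notation "<< u , v >>" := (rkhs_inner H u v).
Local Notation cont0y g := ({within `[0, +oo[, continuous g}).

(** Jensen's inequality, from the supporting line of phi at <Q u, u>. *)
Lemma operator_jensen (phi : R -> R) Q u : orlicz phi -> positive_op Q ->
  vnorm u = 1 -> phi (qf Q u) <= qf (cfc phi Q) u.
Proof.
move=> ophi oQ u1; have [bQ sQ pQ] := oQ.
have [c hc] := orlicz_support ophi (pQ u).
pose p : {poly R} := (phi (qf Q u) - c * qf Q u)%:P + c%:P * 'X.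
have cp := @cont0y_horner R p.
apply: le_trans (cfc_le u oQ cp (orlicz_continuous ophi) _).
  rewrite cfc_horner// {2}/qf poly_opD poly_opM; last exact: bounded_linear.
  rewrite !poly_opC poly_opX dotDl !dotZl dotE u1 expr1n (symm_dotE u sQ).
  by rewrite -!rmorphM -rmorphD /=; lra.
by move=> s s0; have := hc s s0; rewrite /p !hornerE; lra.
Qed.

Lemma symm_iter n T : symm T -> symm (iter n T).
Proof.
move=> sT; elim: n => [|n IH] u v //.
by rewrite iterS sT IH -iterSr.
Qed.

Lemma bounded_iter n T : bounded_operator T -> bounded_operator (iter n T).
Proof.
by move=> bT; elim: n => [|n IH]; [exact: bounded_id|exact: (bounded_comp bT IH)].
Qed.

Lemma qf_iter2 n T u : symm T -> qf (iter (n + n) T) u = vnorm (iter n T u) ^+ 2.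
Proof. by move=> sT; rewrite /qf iterD (symm_iter n sT) vnorm_sqr. Qed.

Lemma positive_iter_even n T : bounded_operator T -> symm T ->
  positive_op (iter (n + n) T).
Proof.
move=> bT sT; split; [exact: bounded_iter|exact: symm_iter|] => u.
by rewrite qf_iter2// sqr_ge0.
Qed.

Section MixedSchwarz.
Variable A : H -> H.
Hypothesis bA : bounded_operator A.

Lemma gram_positive : positive_op (adjoint A \o A).
Proof.
split; first exact: bounded_comp (adjoint_bounded bA) bA.
- move=> u v /=; rewrite -(adjointE bA) dotC -(adjointE bA) -dotC //.
- move=> u; rewrite /qf /= dotC -(adjointE bA) dotE /=.
  by rewrite sqr_ge0.
Qed.

Lemma cont0y_sqrt : cont0y (Num.sqrt : R -> R).
Proof. exact: continuous_subspaceT (@sqrt_continuous R). Qed.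

Lemma cont0y_mul f g : cont0y f -> cont0y g -> cont0y (f \* g).
Proof. by move=> cf cg x; apply: continuousM; [exact: cf|exact: cg]. Qed.

Lemma abs_op_positive : positive_op (abs_op A).
Proof.
apply: cfc_psd; [exact: gram_positive|exact: cont0y_sqrt|].
by move=> x _; exact: sqrtr_ge0.
Qed.

Lemma abs_op_sqr : abs_op A \o abs_op A = adjoint A \o A.
Proof.
have oG := gram_positive; have cs := cont0y_sqrt.
have cX := @cont0y_horner R 'X.
rewrite /abs_op -cfc_mul//; last exact: cont0y_mul.
rewrite (cfc_eq (g := horner 'X) oG) //; last first.
- by move=> x x0; rewrite hornerX /= -expr2 sqr_sqrtr.
- exact: cont0y_mul.
by rewrite cfc_horner//; apply/funext => u; rewrite poly_opX.
Qed.

End MixedSchwarz.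

Lemma abs_op_adjoint_sqr A : bounded_operator A ->
  abs_op (adjoint A) \o abs_op (adjoint A) = A \o adjoint A.
Proof. by move=> bA; rewrite abs_op_sqr ?adjointK//; exact: adjoint_bounded. Qed.

Lemma cfc_abs_intertwine A f : bounded_operator A -> cont0y f ->
  forall u, A (cfc f (abs_op A) u) = cfc f (abs_op (adjoint A)) (A u).
Proof.
move=> bA cf; have bA' := adjoint_bounded bA.
have oG := gram_positive bA; have oG' := gram_positive bA'.
apply: cfc_intertwine => //; try exact: abs_op_positive.
apply: cfc_intertwine => //; first exact: cont0y_sqrt.
by move=> v /=; rewrite adjointK.
Qed.

(** The generalised mixed Schwarz inequality. With W = g(|A|)^2 + e and
    b = A^* y, the Cauchy-Schwarz inequality for W gives
    |<x, b>|^2 <= <W x, x> <W^-1 b, b>, and A W^-1 A^* = r(|A^*|) |A^*|^2 with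
    r = 1 / (g^2 + e), where r s^2 = r g^2 h^2 <= h^2. *)
Lemma mixed_schwarz A g h x y : bounded_operator A -> cont0y g -> cont0y h ->
  (forall s, 0 <= s -> g s * h s = s) ->
  cabs <<A x, y>> ^+ 2 <=
  vnorm (cfc g (abs_op A) x) ^+ 2 * vnorm (cfc h (abs_op (adjoint A)) y) ^+ 2.
Proof.
move=> bA cg ch gh; have bA' := adjoint_bounded bA.
have oP := abs_op_positive bA; have oQ := abs_op_positive bA'.
set P := abs_op A in oP *; set Q := abs_op (adjoint A) in oQ *.
set G := cfc g P; set K := cfc h Q.
rewrite -subr_le0.
apply: (@ler_of_le_scaled R _ (vnorm x ^+ 2 * vnorm (K y) ^+ 2)) => e e0 _.
pose c := horner (e%:P : {poly R}); have cc : cont0y c := @cont0y_horner R _.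
pose gg := g \* g; have cgg : cont0y gg := cont0y_mul cg cg.
pose w := gg \+ c; have cw : cont0y w.
  by move=> s; apply: continuousD; [exact: cgg|exact: cc].
have w0 s : 0 < w s by rewrite /w /c /= hornerC ltr_wpDl// /gg /= -expr2 sqr_ge0.
pose r := fun s => (w s)^-1; have cr : cont0y r.
  by move=> s; apply: continuousV; [rewrite gt_eqF|exact: cw].
pose hh := h \* h; have chh : cont0y hh := cont0y_mul ch ch.
pose rX := r \* horner ('X * 'X).
have cXX := @cont0y_horner R ('X * 'X).
have crX : cont0y rX := cont0y_mul cr cXX.
have oW : positive_op (cfc w P) by apply: cfc_psd => // s _; exact: ltW.
have qW u : qf (cfc w P) u = vnorm (G u) ^+ 2 + e * vnorm u ^+ 2.
  rewrite /w cfc_add// /gg cfc_mul// cfc_horner// /qf /= poly_opC dotDl dotZl.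
  by rewrite (cfc_symm oP cg) !dotE -rmorphM -rmorphD.
have WR u : cfc w P (cfc r P u) = u.
  have -> : cfc w P (cfc r P u) = cfc (w \* r) P u.
    by rewrite cfc_mul//; exact: cont0y_mul.
  have c1 := @cont0y_horner R 1.
  rewrite (cfc_eq (g := horner 1) oP) ?cfc_horner//; last first.
  - by move=> s _; rewrite /= /r mulfV ?gt_eqF// hornerC.
  - exact: cont0y_mul.
  by rewrite poly_opC scale1r.
set b := adjoint A y; set z := cfc r P b.
have [bW sW pW] := oW.
have e1 : <<A x, y>> = <<cfc w P x, z>>.
  by rewrite (adjointE bA) -/b sW /z WR.
have e2 : qf (cfc w P) z = qf (cfc rX Q) y.
  rewrite /qf.
  have lQ : linear Q by case: oQ => /bounded_linear.
  have -> : cfc rX Q y = A z.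
    rewrite /rX cfc_mul// cfc_horner// /= poly_opM// !poly_opX.
    rewrite /z (cfc_abs_intertwine bA cr) -/Q.
    by have /(congr1 (@^~ y)) /= := abs_op_adjoint_sqr bA; rewrite -/Q => ->.
  by rewrite WR (adjointE bA) -/b dotC; case: <<z, b>>.
have CS := psd_cauchy_schwarz x z sW pW.
rewrite (qW x) e2 -e1 in CS; clear e1 e2.
have rh : qf (cfc rX Q) y <= vnorm (K y) ^+ 2.
  have -> : vnorm (K y) ^+ 2 = qf (cfc hh Q) y.
    by rewrite /hh cfc_mul// /qf /= (cfc_symm oQ ch) dotE.
  apply: cfc_le => // s s0; rewrite /rX /r /hh /= hornerM !hornerX.
  rewrite mulrC ler_pdivrMr// -{1 2}(gh s s0) /w /gg /c /= hornerC.
  rewrite mulrDr; apply: le_trans (_ : h s * h s * (g s * g s) <= _).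
    by rewrite le_eqVlt; apply/orP; left; apply/eqP; ring.
  by rewrite lerDl mulr_ge0 ?(ltW e0)// -expr2 sqr_ge0.
have qx : 0 <= vnorm (G x) ^+ 2 + e * vnorm x ^+ 2.
  by rewrite addr_ge0 ?sqr_ge0// mulr_ge0 ?sqr_ge0 ?(ltW e0).
have := ler_wpM2l qx rh.
by rewrite mulrDl; lra.
Qed.

(** Buzano's inequality: the reflection u' = 2 <u, k> k - u has the norm of u,
    and <u', v> = 2 <u, k> <k, v> - <u, v>. *)
Lemma buzano u v k : vnorm k = 1 ->
  cabs (<<u, k>> * <<k, v>>) <= 2^-1 * (vnorm u * vnorm v + cabs <<u, v>>).
Proof.
move=> k1; set a := <<u, k>>.
pose u' : H := (2 * a) *: k - u.
have nu : vnorm u' = vnorm u.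
  apply/eqP; rewrite -(eqrXn2 (n := 2)) ?vnorm_ge0//; apply/eqP.
  rewrite /u' vnormD_sqr vnormN vnormZ k1 mulr1 cabsM exprMn dotNr dotZl.
  rewrite (dotC k u) -/a !cabs_sqr; case: (a) => s t /=; ring.
have : cabs (2 * (a * <<k, v>>) - <<u, v>>) <= vnorm u * vnorm v.
  rewrite -nu; apply: le_trans (cauchy_schwarz _ _).
  by rewrite /u' dotBl dotZl mulrA.
have := ler_cabsD (2 * (a * <<k, v>>) - <<u, v>>) <<u, v>>.
rewrite subrK cabsM (_ : cabs (2 : R[i]) = 2); first lra.
by rewrite -[2]/(2%:R) -(rmorph_nat (real_complex R)) cabsR normr_nat.
Qed.

End OperatorInequalities.

(** * Berezin numbers *)

Section Berezin.
Context {R : realType} {Omega : Type} {H : rkhs R Omega}.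
Hypothesis Omega_neq0 : inhabited Omega.
Hypothesis rkernel_neq0 : forall l : Omega, rkernel l <> 0 :> H.
Implicit Types (T : H -> H) (l : Omega).
Local Notation "<< u , v >>" := (rkhs_inner H u v).
Local Notation nk l := (nrkernel l : H).

Lemma vnorm_nrkernel l : vnorm (nk l) = 1.
Proof.
have /eqP k0 := @rkernel_neq0 l.
rewrite /nrkernel vnormZ vnormE -fmorphV cabsR.
by rewrite gtr0_norm ?invr_gt0 ?vnorm_gt0// mulVf// gt_eqF ?vnorm_gt0.
Qed.

Lemma has_sup_ber T : bounded_operator T ->
  has_sup [set complex.Re `| <<T (nk l), nk l>> | | l in [set: Omega]].
Proof.
move=> bT; have [l0] := Omega_neq0.
have [lT [K K0 hK]] := (bounded_operatorP _).1 bT.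
split; first by exists (cabs <<T (nk l0), nk l0>>), l0.
exists K => _ [l _ <-]; apply: le_trans (cauchy_schwarz _ _) _.
rewrite vnorm_nrkernel mulr1; apply: le_trans (hK _) _.
by rewrite vnorm_nrkernel mulr1.
Qed.

Lemma cabs_le_ber T l : bounded_operator T -> cabs <<T (nk l), nk l>> <= ber T.
Proof.
move=> bT; apply: sup_upper_bound; last by exists l.
exact: has_sup_ber.
Qed.

Lemma qf_le_ber T l : bounded_operator T -> qf T (nk l) <= ber T.
Proof. by move=> bT; apply: le_trans (ler_Re_cabs _) (cabs_le_ber l bT). Qed.

(** As phi is continuous, phi(ber(T)^2) is bounded by any bound of the values
    phi(|<T k, k>|^2). *)
Lemma orlicz_ber_le (phi : R -> R) T C : bounded_operator T ->
  orlicz phi -> (forall l, phi (cabs <<T (nk l), nk l>> ^+ 2) <= C) ->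
  phi (ber T ^+ 2) <= C.
Proof.
move=> bT ophi hC; have hs := has_sup_ber bT.
have [l0] := Omega_neq0.
have b0 : 0 <= ber T := le_trans (cabs_ge0 _) (cabs_le_ber l0 bT).
apply/ler_addgt0Pl => e e0.
have b2I : `[0, +oo[%classic (ber T ^+ 2) by rewrite /= in_itv /= sqr_ge0.
have cphi := orlicz_continuous ophi.
have [d d0 hd] := (within_continuous_distP _ _).1 cphi _ _ b2I e0.
have d'0 : 0 < d / (2 * ber T + 1) by rewrite divr_gt0// ltr_wpDl// mulr_ge0.
have [_ [l _ <-]] := sup_adherent d'0 hs.
rewrite -/(ber T) -/(cabs _); set a := cabs _ => al.
have ab : a <= ber T := cabs_le_ber l bT.
have a0 : 0 <= a := cabs_ge0 _.
have : `|phi (ber T ^+ 2) - phi (a ^+ 2)| <= e.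
  apply: hd; first by rewrite /= in_itv /= sqr_ge0.
  rewrite ger0_norm ?subr_ge0 ?ler_pXn2r ?nnegrE//.
  have {}al : (ber T - a) * (2 * ber T + 1) < d.
    by rewrite -ltr_pdivlMr ?ltr_wpDl ?mulr_ge0//; lra.
  apply: le_lt_trans al; rewrite subr_sqr ler_wpM2l; lra.
by rewrite ler_norml; have := hC l; rewrite -/a; lra.
Qed.

(** The Berezin number estimate for any pair of bounded symmetric operators G, K
    satisfying a mixed Schwarz inequality for A. *)
Lemma ber_orlicz_bound (A G K : H -> H) (phi : R -> R) (F : R) :
  bounded_operator A -> bounded_operator G -> symm G ->
  bounded_operator K -> symm K ->
  (forall x y, cabs <<A x, y>> ^+ 2 <= vnorm (G x) ^+ 2 * vnorm (K y) ^+ 2) ->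
  orlicz phi -> submultiplicative phi -> 0 <= F ->
  phi (ber A ^+ 2) <=
    F / (2 * (1 + F)) *
      (2^-1 * ber (cfc phi (iter 4 G) \+ cfc phi (iter 4 K))
       + phi (ber (iter 2 K \o iter 2 G)))
    + 1 / (2 * (1 + F)) *
      (phi (ber A) * ber (cfc phi (iter 2 G) \+ cfc phi (iter 2 K))).
Proof.
move=> bA bG sG bK sK schwarz phi_orlicz phi_subm F0.
have og2 := positive_iter_even 1 bG sG; have oh2 := positive_iter_even 1 bK sK.
have og4 := positive_iter_even 2 bG sG; have oh4 := positive_iter_even 2 bK sK.
have cphi := orlicz_continuous phi_orlicz.
have bphi (Q : H -> H) : positive_op Q -> bounded_operator (cfc phi Q).
  by move=> oQ; exact: cfc_bounded.
have bS4 : bounded_operator (cfc phi (iter 4 G) \+ cfc phi (iter 4 K)).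
  by apply: bounded_add; exact: bphi.
have bS2 : bounded_operator (cfc phi (iter 2 G) \+ cfc phi (iter 2 K)).
  by apply: bounded_add; exact: bphi.
have bM : bounded_operator (iter 2 K \o iter 2 G).
  by apply: bounded_comp; exact: bounded_iter.
apply: orlicz_ber_le => // l; set k : H := nrkernel l.
have k1 : vnorm k = 1 := vnorm_nrkernel l.
set a := cabs _; have a0 : 0 <= a := cabs_ge0 _.
have phi0 := orlicz_ge0 phi_orlicz.
have qfD2 (S T : H -> H) : qf (S \+ T) k = qf S k + qf T k.
  by rewrite /qf /= dotDl; case: (rkhs_inner H _ _) (rkhs_inner H (T k) k) => ? ? [].
(* Jensen applied to two positive operators. *)
have mid S T : positive_op S -> positive_op T ->
    phi (2^-1 * (qf S k + qf T k)) <= 2^-1 * ber (cfc phi S \+ cfc phi T).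
  move=> oS oT; have [_ _ pS] := oS; have [_ _ pT] := oT.
  apply: le_trans (orlicz_mid phi_orlicz (pS k) (pT k)) _.
  rewrite ler_wpM2l ?invr_ge0//.
  apply: le_trans _ (qf_le_ber l (bounded_add (bphi _ oS) (bphi _ oT))).
  by rewrite qfD2 lerD// operator_jensen.
have [_ _ pg2] := og2; have [_ _ ph2] := oh2.
have aXY : a ^+ 2 <= qf (iter 2 G) k * qf (iter 2 K) k 
  by rewrite (qf_iter2 1 k sG) (qf_iter2 1 k sK); exact: schwarz.
(* Buzano's inequality at u = G^2 k and v = K^2 k. *)
have first : phi (a ^+ 2) <= 2^-1 *
    (2^-1 * ber (cfc phi (iter 4 G) \+ cfc phi (iter 4 K))
     + phi (ber (iter 2 K \o iter 2 G))).
  set u := iter 2 G k; set v := iter 2 K k.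
  have hB : cabs <<u, v>> <= ber (iter 2 K \o iter 2 G).
    apply: le_trans _ (cabs_le_ber l bM).
    by rewrite -/k (_ : <<_ k, k>> = <<u, v>>)//; exact: (symm_iter 2 sK u k).
  have uv : vnorm u * vnorm v <= 2^-1 * (qf (iter 4 G) k + qf (iter 4 K) k).
    rewrite (qf_iter2 2 k sG) (qf_iter2 2 k sK) -/u -/v.
    by have := sqr_ge0 (vnorm u - vnorm v); rewrite sqrrB; lra.
  have XY : qf (iter 2 G) k * qf (iter 2 K) k <=
      2^-1 * (vnorm u * vnorm v + cabs <<u, v>>).
    apply: le_trans _ (buzano u v k1); rewrite cabsM.
    have [_ s2 _] := og2; have [_ s2' _] := oh2.
    rewrite [X in X * _](_ : _ = cabs <<u, k>>); last first.
      by rewrite /u (symm_dotE k s2) cabsR ger0_norm.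
    by rewrite [rkhs_inner H k v]dotC cabs_conj /v (symm_dotE k s2') cabsR ger0_norm.
  have U0 : 0 <= vnorm u * vnorm v by rewrite mulr_ge0 ?vnorm_ge0.
  have B0 := cabs_ge0 <<u, v>>.
  apply: le_trans (_ : phi (2^-1 * (2^-1 * (qf (iter 4 G) k + qf (iter 4 K) k) +
      ber (iter 2 K \o iter 2 G))) <= _).
    apply: (orlicz_le phi_orlicz); first by rewrite sqr_ge0.
    by lra.
  apply: le_trans (orlicz_mid phi_orlicz _ _) _; [lra|lra|].
  by rewrite ler_wpM2l ?invr_ge0// lerD2r; exact: mid.
(* Sub-multiplicativity and the arithmetic-geometric mean inequality. *)
have second : phi (a ^+ 2) <= 2^-1 * (phi (ber A) *
    ber (cfc phi (iter 2 G) \+ cfc phi (iter 2 K))).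
  have X0 := pg2 k; have Y0 := ph2 k.
  have aD : a <= 2^-1 * (qf (iter 2 G) k + qf (iter 2 K) k).
    move: (qf _ k) (qf (iter 2 K) k) X0 Y0 aXY => X Y X0 Y0 aXY.
    rewrite -(ler_pXn2r (n := 2)) ?nnegrE ?mulr_ge0 ?addr_ge0 ?invr_ge0//.
    by apply: le_trans aXY _; have := sqr_ge0 (X - Y); rewrite !expr2; lra.
  have pa : phi a <= 2^-1 * ber (cfc phi (iter 2 G) \+ cfc phi (iter 2 K)).
    by apply: le_trans (orlicz_le phi_orlicz a0 aD) _; exact: mid.
  have paA : phi a <= phi (ber A).
    by apply: (orlicz_le phi_orlicz) => //; exact: cabs_le_ber.
  rewrite expr2; apply: le_trans (phi_subm a a a0 a0) _.
  by rewrite mulrCA ler_pM ?phi0.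
(* The two bounds are averaged with the weights F / (1 + F) and 1 / (1 + F). *)
move: first second; move: (phi (a ^+ 2)) (_ + _) (_ * ber _) => z X Y zX zY.
have -> : z = F / (1 + F) * z + 1 / (1 + F) * z by field; lra.
have -> : F / (2 * (1 + F)) * X = F / (1 + F) * (2^-1 * X) by field; lra.
have -> : 1 / (2 * (1 + F)) * Y = 1 / (1 + F) * (2^-1 * Y) by field; lra.
by rewrite lerD// ler_wpM2l// divr_ge0//; lra.
Qed.

End Berezin.

Theorem theorem3p1 (R : realType) (Omega : Type) (Omega_neq0 : inhabited Omega)
  (H : rkhs R Omega) (rkernel_neq0 : forall l : Omega, rkernel l <> 0 :> H)
  (A : H -> H) (A_bounded : bounded_operator A)
  (g h : R -> R)
  (g_ge0 : forall s : R, 0 <= s -> 0 <= g s)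
  (h_ge0 : forall s : R, 0 <= s -> 0 <= h s)
  (g_continuous : {within `[0, +oo[, continuous g})
  (h_continuous : {within `[0, +oo[, continuous h})
  (gh : forall s : R, 0 <= s -> g s * h s = s)
  (f : R -> R) (f_ge0 : forall s : R, 0 < s < 1 -> 0 <= f s)
  (t : R) (t01 : 0 < t < 1)
  (phi : R -> R) (phi_orlicz : orlicz phi) (phi_subm : submultiplicative phi) :
  let gA := cfc g (abs_op A) in
  let hA := cfc h (abs_op (adjoint A)) in
  phi (ber A ^+ 2) <=
    f t / (2 * (1 + f t)) *
      (2^-1 * ber (cfc phi (iter 4 gA) \+ cfc phi (iter 4 hA))
       + phi (ber (iter 2 hA \o iter 2 gA)))
    + 1 / (2 * (1 + f t)) *
      (phi (ber A) * ber (cfc phi (iter 2 gA) \+ cfc phi (iter 2 hA))).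
Proof.
cbv zeta; have bA' := adjoint_bounded A_bounded.
have oP := abs_op_positive A_bounded; have oQ := abs_op_positive bA'.
apply: ber_orlicz_bound => //.
- exact: cfc_bounded.
- exact: cfc_symm.
- exact: cfc_bounded.
- exact: cfc_symm.
- by move=> x y; exact: mixed_schwarz.
- exact: f_ge0.
Qed.
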